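(* Let $K$ be a field with $\mathrm{char}(K)=2$, let $R=K[[x,y]]$ with maximal ideal $\mathfrak{m}=\langle x,y\rangle$, let the contact group $\mathcal{K}=R^*\rtimes Aut(R)$ act on $R$, and let $f=x^2+y^3\in R$. Then the tangent image $\widetilde T_f(\mathcal{K}f)$ is strictly contained in the tangent space $T_f(\mathcal{K}f)$. More precisely: (1) $\widetilde T_f(\mathcal{K}f)=\langle x^2,xy^2,y^3\rangle$, and its codimension in $K[[x,y]]$ is $5$. (2) $f$ is $\mathcal{K}$ $4$-determined, and its pre-determinacy bound with respect to $\mathcal{K}$ is $p=2$. (3) $K[[x,y]]^{(2)}=K[[x,y]]/\mathfrak{m}^3$ has dimension $6$. (4) The group $\mathcal{K}^{(2)}$ has dimension $16$ and the stabilizer of $jet_2(f)$ in $\mathcal{K}^{(2)}$ has dimension $14$. (5) The orbit $\mathcal{K}^{(2)}f$ has dimension $2$ and codimension $4$ in $K[[x,y]]^{(2)}$; the codimension of the tangent space $T_f(\mathcal{K}f)$ in $K[[x,y]]$ is also $4$; and the orbit map $\mathcal{K}^{(2)}\to\mathcal{K}^{(2)}f$ is not separable.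
   Context: $R=K[[x,y]]$, $\mathfrak{m}=\langle x,y\rangle$. $Aut(R)$ is the group of $K$-algebra automorphisms of $R$; the contact group $\mathcal{K}=R^*\rtimes Aut(R)$ acts on $R$ by $(u,\phi)\cdot f=u\cdot\phi(f)$, where $\phi(f)=f(\phi(x),\phi(y))$. $f$ is $\mathcal{K}$ $k$-determined if every $g\in R$ with $g-f\in\mathfrak{m}^{k+1}$ lies in the $\mathcal{K}$-orbit $\mathcal{K}f$. For $f\in\mathfrak{m}$ the tangent image is $\widetilde T_f(\mathcal{K}f)=\langle f\rangle+\mathfrak{m}\cdot\langle\partial f/\partial x,\partial f/\partial y\rangle$, an ideal of $R$. The pre-determinacy bound of $f$ with respect to $\mathcal{K}$ is the minimal integer $p\ge0$ with $\mathfrak{m}^{p+1}\subset\widetilde T_f(\mathcal{K}f)$. For $a\in R$, $jet_k(a)$ is the class of $a$ in $R^{(k)}=R/\mathfrak{m}^{k+1}$. $\mathcal{K}^{(k)}=\{(jet_k(u),jet_k(\phi))\mid(u,\phi)\in\mathcal{K}\}$, where $jet_k(\phi)$ is given by $x\mapsto jet_k(\phi(x))$, $y\mapsto jet_k(\phi(y))$; it is an affine algebraic group acting algebraically on the affine space $R^{(k)}$ by $(jet_k(g),jet_k(f))\mapsto jet_k(gf)$. $\mathcal{K}^{(k)}f$ denotes the orbit of $jet_k(f)$, a locally closed subvariety of $R^{(k)}$; the orbit map is $g\mapsto jet_k(gf)$. Varieties are considered as sets with the Zariski topology over the algebraic closure $\bar K$, defined over $K$; separability of the orbit map means that the induced extension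 of function fields is separable. Let $T_f^{(k)}(\mathcal{K}f)\subset R^{(k)}$ be the tangent space at $jet_k(f)$ to the orbit $\mathcal{K}^{(k)}jet_k(f)$. The tangent space is $T_f(\mathcal{K}f)=\varprojlim_{k\ge0}T_f^{(k)}(\mathcal{K}f)\subset R$, i.e. the set of $b\in R$ with $jet_k(b)\in T_f^{(k)}(\mathcal{K}f)$ for all $k\ge0$. Codimensions of $\widetilde T_f(\mathcal{K}f)$ and $T_f(\mathcal{K}f)$ are as $K$-subspaces of $R$. *)

(* Defs.v *)
From HB Require Import structures.
From mathcomp Require Import all_boot all_order all_algebra.
From mathcomp Require Import separable.
From mathcomp Require Import boolp classical_sets.
From mathcomp Require Import mpoly.

Set Implicit Arguments.
Unset Strict Implicit.
Unset Printing Implicit Defensive.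

Import GRing.Theory.
Local Open Scope classical_set_scope.
Local Open Scope ring_scope.

(** * Ideals of a commutative ring, and codimension of a linear subspace *)

Section Ideals.
Variable R : comNzRingType.
Implicit Types (S I J : set R).

Definition ideal_gen S : set R :=
  [set a | exists n (c s : 'I_n -> R),
     (forall i, S (s i)) /\ a = \sum_(i < n) c i * s i].

Definition ideal_add I J : set R :=
  [set a | exists b c, [/\ I b, J c & a = b + c]].

Definition ideal_mul I J : set R :=
  ideal_gen [set a | exists b c, [/\ I b, J c & a = b * c]].

Definition ideal_exp I n : set R := iter n (ideal_mul I) setT.

End Ideals.

(* For a linear subspace W of V: the quotient V / W has a basis of d elements,
   namely the classes of the e i. *)
Definition has_codim (K : fieldType) (V : lmodType K) (W : set V) (d : nat) :=
  exists e : 'I_d -> V,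
    forall v, exists! c : {ffun 'I_d -> K}, W (v - \sum_(i < d) c i *: e i).

(** * The power series ring K[[x,y]] *)

(* [coef f i j] is the coefficient of x^i y^j. *)
Record pseries (K : Type) := PSeries { coef : nat -> nat -> K }.

HB.instance Definition _ K := gen_eqMixin (pseries K).
HB.instance Definition _ K := gen_choiceMixin (pseries K).

Lemma pseriesP K (f g : pseries K) :
  (forall i j, coef f i j = coef g i j) -> f = g.
Proof.
case: f g => f [g] /= fg; congr PSeries.
by apply/funext => i; apply/funext => j.
Qed.

Section PowerSeries.
Variable K : fieldType.
Implicit Types f g h : pseries K.

Definition ps_zero : pseries K := PSeries (fun _ _ => 0).
Definition ps_opp f := PSeries (fun i j => - coef f i j).
Definition ps_add f g := PSeries (fun i j => coef f i j + coef g i j).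
Definition ps_mono a b : pseries K :=
  PSeries (fun i j => ((i == a) && (j == b))%:R).
Definition ps_scale (c : K) f := PSeries (fun i j => c * coef f i j).
Definition ps_mul f g :=
  PSeries (fun i j => \sum_(a < i.+1) \sum_(b < j.+1)
                        coef f a b * coef g (i - a) (j - b)).

Fact ps_addA : associative ps_add.
Proof. by move=> f g h; apply: pseriesP => i j /=; rewrite addrA. Qed.
Fact ps_addC : commutative ps_add.
Proof. by move=> f g; apply: pseriesP => i j /=; rewrite addrC. Qed.
Fact ps_add0 : left_id ps_zero ps_add.
Proof. by move=> f; apply: pseriesP => i j /=; rewrite add0r. Qed.
Fact ps_addN : left_inverse ps_zero ps_opp ps_add.
Proof. by move=> f; apply: pseriesP => i j /=; rewrite addNr. Qed.

HB.instance Definition _ :=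
  GRing.isZmodule.Build (pseries K) ps_addA ps_addC ps_add0 ps_addN.

(* Truncation to a polynomial in y over K[x], used to derive the ring axioms. *)
Let trunc n f : {poly {poly K}} :=
  \poly_(j < n) \poly_(i < n) coef f i j.

Let truncE n f i j : (i < n)%N -> (j < n)%N -> ((trunc n f)`_j)`_i = coef f i j.
Proof. by move=> ltin ltjn; rewrite !(coef_poly, ltin, ltjn). Qed.

Let coefM2 (p q : {poly {poly K}}) i j :
  ((p * q)`_j)`_i =
  \sum_(a < i.+1) \sum_(b < j.+1) (p`_b)`_a * (q`_(j - b))`_(i - a).
Proof.
rewrite coefM coef_sum exchange_big /=.
by apply: eq_bigr => b _; rewrite coefM.
Qed.

Let truncM n f g i j : (i < n)%N -> (j < n)%N ->
  ((trunc n f * trunc n g)`_j)`_i = coef (ps_mul f g) i j.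
Proof.
move=> ltin ltjn; rewrite coefM2 /=; apply: eq_bigr => a _.
apply: eq_bigr => b _; have := ltn_ord a; have := ltn_ord b.
rewrite !ltnS => lebj leai; rewrite !truncE //.
- exact: leq_ltn_trans (leq_subr _ _) ltin.
- exact: leq_ltn_trans (leq_subr _ _) ltjn.
- exact: leq_ltn_trans leai ltin.
- exact: leq_ltn_trans lebj ltjn.
Qed.

Fact ps_mulC : commutative ps_mul.
Proof.
move=> f g; apply: pseriesP => i j; have n0 := ltnSn (maxn i j).
have [ltin ltjn] : (i < (maxn i j).+1 /\ j < (maxn i j).+1)%N.
  by rewrite !ltnS leq_maxl leq_maxr.
by rewrite -!(truncM _ _ ltin ltjn) mulrC.
Qed.

Fact ps_mulA : associative ps_mul.
Proof.
move=> f g h; apply: pseriesP => i j.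
set n := (maxn i j).+1.
have [ltin ltjn] : (i < n /\ j < n)%N by rewrite !ltnS leq_maxl leq_maxr.
transitivity (((trunc n f * (trunc n g * trunc n h))`_j)`_i).
  rewrite coefM2 /=; apply: eq_bigr => a _; apply: eq_bigr => b _.
  have := ltn_ord a; have := ltn_ord b; rewrite !ltnS => lebj leai.
  rewrite truncE ?(leq_ltn_trans leai) ?(leq_ltn_trans lebj) //.
  by rewrite truncM //; apply: leq_ltn_trans (leq_subr _ _) _.
rewrite mulrA coefM2 /=; apply: eq_bigr => a _; apply: eq_bigr => b _.
have := ltn_ord a; have := ltn_ord b; rewrite !ltnS => lebj leai.
rewrite truncM ?(leq_ltn_trans leai) ?(leq_ltn_trans lebj) //.
by rewrite truncE //; apply: leq_ltn_trans (leq_subr _ _) _.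
Qed.

Fact ps_mulDl : left_distributive ps_mul +%R.
Proof.
move=> f g h; apply: pseriesP => i j /=; rewrite -big_split /=.
apply: eq_bigr => a _; rewrite -big_split /=.
by apply: eq_bigr => b _; rewrite mulrDl.
Qed.

Lemma coef_monoM a b f i j :
  coef (ps_mul (ps_mono a b) f) i j =
  if (a <= i)%N && (b <= j)%N then coef f (i - a) (j - b) else 0.
Proof.
rewrite /=; case: ifP => [/andP[leai lebj]|nle].
  rewrite (bigD1 (inord a : 'I_i.+1)) //= (bigD1 (inord b : 'I_j.+1)) //=.
  rewrite !inordK ?ltnS // !eqxx mul1r !big1 ?addr0 // => k.
    move=> nk; rewrite big1 // => l _; case: eqP => [ka|_]; last by rewrite mul0r.
    by case/eqP: nk; apply: val_inj; rewrite /= inordK.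
  move=> nk; case: eqP => [kb|_]; last by rewrite andbF mul0r.
  by case/eqP: nk; apply: val_inj; rewrite /= inordK.
rewrite big1 // => k _; rewrite big1 // => l _.
case: andP => [[/eqP ka /eqP lb]|_]; last by rewrite mul0r.
by move: nle; rewrite -ka -lb !leq_ord.
Qed.

Fact ps_mul1 : left_id (ps_mono 0 0) ps_mul.
Proof. by move=> f; apply: pseriesP => i j; rewrite coef_monoM !subn0. Qed.

Fact ps_one_neq0 : ps_mono 0 0 != 0.
Proof.
apply/eqP => /(congr1 (fun f => coef f 0 0)) /= /eqP.
by rewrite oner_eq0.
Qed.

HB.instance Definition _ :=
  GRing.Zmodule_isComNzRing.Build (pseries K)
    ps_mulA ps_mulC ps_mul1 ps_mulDl ps_one_neq0.

Fact ps_scaleA a b f : ps_scale a (ps_scale b f) = ps_scale (a * b) f.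
Proof. by apply: pseriesP => i j /=; rewrite mulrA. Qed.
Fact ps_scale1 : left_id 1 ps_scale.
Proof. by move=> f; apply: pseriesP => i j /=; rewrite mul1r. Qed.
Fact ps_scaleDr : right_distributive ps_scale +%R.
Proof. by move=> a f g; apply: pseriesP => i j /=; rewrite mulrDr. Qed.
Fact ps_scaleDl f : {morph ps_scale^~ f : a b / a + b}.
Proof. by move=> a b; apply: pseriesP => i j /=; rewrite mulrDl. Qed.

HB.instance Definition _ :=
  GRing.Zmodule_isLmodule.Build K (pseries K)
    ps_scaleA ps_scale1 ps_scaleDr ps_scaleDl.

Fact ps_scaleAl (a : K) f g : a *: (f * g) = a *: f * g.
Proof.
apply: pseriesP => i j /=; rewrite mulr_sumr; apply: eq_bigr => k _.
by rewrite mulr_sumr; apply: eq_bigr => l _; rewrite mulrA.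
Qed.

HB.instance Definition _ :=
  GRing.Lmodule_isLalgebra.Build K (pseries K) ps_scaleAl.
HB.instance Definition _ := GRing.Lalgebra_isComAlgebra.Build K (pseries K).

Definition psX : pseries K := ps_mono 1 0.
Definition psY : pseries K := ps_mono 0 1.

Definition ps_dx f := PSeries (fun i j => coef f i.+1 j *+ i.+1).
Definition ps_dy f := PSeries (fun i j => coef f i j.+1 *+ j.+1).

Definition maxideal : set (pseries K) := ideal_gen [set psX; psY].

End PowerSeries.

Arguments psX {K}.
Arguments psY {K}.
Arguments maxideal {K}.

Definition map_ps (K L : Type) (iota : K -> L) (f : pseries K) : pseries L :=
  PSeries (fun i j => iota (coef f i j)).

(** * The contact group, determinacy and the tangent image *)

Section Contact.
Variable K : fieldType.
Implicit Types f h : pseries K.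

Record contact := Contact {
  cunit : pseries K;
  caut : {lrmorphism pseries K -> pseries K};
  cunitP : exists v, cunit * v = 1;
  cautP : bijective caut
}.

Definition cact (g : contact) f : pseries K := cunit g * caut g f.

Definition corbit f : set (pseries K) := range (cact^~ f).

Definition determined k f :=
  forall h, ideal_exp maxideal k.+1 (h - f) -> corbit f h.

Definition tangent_image f : set (pseries K) :=
  ideal_add (ideal_gen [set f])
            (ideal_mul maxideal (ideal_gen [set ps_dx f; ps_dy f])).

Definition predeterminacy_bound f p :=
  ideal_exp maxideal p.+1 `<=` tangent_image f /\
  forall q, ideal_exp maxideal q.+1 `<=` tangent_image f -> (p <= q)%N.

End Contact.

(** * Zariski topology on affine space, dimension, tangent spaces, function
      fields, separable morphisms *)

Section Zariski.
Variables (L : fieldType) (I : finType).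
(* Affine space with coordinates indexed by I. *)
Implicit Types (a v : {ffun I -> L}) (X Z : set {ffun I -> L}).
Implicit Types P Q : {mpoly L[#|I|]}.

Definition peval P a : L := P.@[fun i => a (enum_val i)].

Definition vanishing X : set {mpoly L[#|I|]} :=
  [set P | forall a, X a -> peval P a = 0].

Definition closed_in X Z :=
  exists S : set {mpoly L[#|I|]},
    Z = X `&` [set a | forall P, S P -> peval P a = 0].

Definition irreducible_set Z :=
  Z !=set0 /\
  forall Z1 Z2, closed_in Z Z1 -> closed_in Z Z2 ->
    Z = Z1 `|` Z2 -> Z = Z1 \/ Z = Z2.

Definition irred_chain X d (C : nat -> set {ffun I -> L}) :=
  (forall i, (i <= d)%N -> closed_in X (C i) /\ irreducible_set (C i)) /\
  (forall i, (i < d)%N -> C i `<` C i.+1).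

(* Krull dimension of X with the induced topology. *)
Definition has_dim X d :=
  (exists C, irred_chain X d C) /\
  (forall e C, irred_chain X e C -> (e <= d)%N).

Definition has_codim_in X Z c :=
  exists n d, [/\ has_dim X n, has_dim Z d & n = (d + c)%N].

(* For X locally closed, the polynomials vanishing on X and on its closure
   are the same, so this is the tangent space at a of the variety X. *)
Definition tangent_at X a : set {ffun I -> L} :=
  [set v | forall P, vanishing X P ->
     \sum_(i < #|I|) peval (P^`M(i)) a * v (enum_val i) = 0].

(* E, together with ev, is the fraction field of the coordinate ring
   L[I] / vanishing X; this determines E up to isomorphism, and forces X to be
   irreducible. *)
Definition function_field X (E : fieldType)
    (ev : {rmorphism {mpoly L[#|I|]} -> E}) :=
  (forall P, ev P = 0 <-> vanishing X P) /\
  (forall e : E, exists P Q, ev Q != 0 /\ e = ev P / ev Q).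

End Zariski.

(* The field extension iota : F -> E, assumed finitely generated, is separable:
   E has a transcendence basis z over F such that every element of E is a root
   of a separable polynomial with coefficients in F(z). *)
Definition separable_extension (F E : fieldType) (iota : {rmorphism F -> E}) :=
  exists n (z : 'I_n -> E),
    (forall P : {mpoly F[n]}, mmap iota z P = 0 -> P = 0) /\
    (forall e : E, exists q : {poly E},
       [/\ forall i, exists P Q : {mpoly F[n]},
             mmap iota z Q != 0 /\ q`_i = mmap iota z P / mmap iota z Q,
           separable_poly q
         & root q e]).

Section SeparableMorphism.
Variables (L : fieldType) (I J : finType).
Variables (X : set {ffun I -> L}) (Y : set {ffun J -> L}).
(* The graph of a dominant morphism from X to Y. *)
Variable Gamma : {ffun I -> L} -> {ffun J -> L} -> Prop.

(* h is the map induced on function fields: if P o Gamma = Q1 / Q2 on X, then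
   h sends the class of P to the class of Q1 / Q2. *)
Definition pullback (E F : fieldType)
    (evX : {rmorphism {mpoly L[#|I|]} -> E})
    (evY : {rmorphism {mpoly L[#|J|]} -> F}) (h : {rmorphism F -> E}) :=
  forall (P : {mpoly L[#|J|]}) (Q1 Q2 : {mpoly L[#|I|]}),
    (forall a b, Gamma a b -> peval P b * peval Q2 a = peval Q1 a) ->
    h (evY P) * evX Q2 = evX Q1.

(* The function fields being unique up to isomorphism, the choice of E, F is
   immaterial; a proof that a morphism is not separable has to exhibit them. *)
Definition separable_morphism :=
  forall (E F : fieldType)
    (evX : {rmorphism {mpoly L[#|I|]} -> E})
    (evY : {rmorphism {mpoly L[#|J|]} -> F}) (h : {rmorphism F -> E}),
    function_field X evX -> function_field Y evY -> pullback evX evY h ->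
    separable_extension h.

End SeparableMorphism.

(** * Jets *)

Definition jet_index k :=
  {p : 'I_k.+1 * 'I_k.+1 | (p.1 + p.2 <= k)%N}.

Section Jets.
Variables (F : fieldType) (k : nat).
Implicit Types f : pseries F.

(* R / m^(k+1) is identified with the affine space of coefficients of total
   degree at most k; see [jet_eqP] below. *)
Definition jet f : {ffun jet_index k -> F} :=
  [ffun p : jet_index k => coef f (val p).1 (val p).2].

(* An automorphism is given by the images of x and y. *)
Definition contact_index := (jet_index k + (jet_index k + jet_index k))%type.

Definition contact_jet (g : contact F) : {ffun contact_index -> F} :=
  [ffun s : contact_index => match s with
             | inl p => jet (cunit g) p
             | inr (inl p) => jet (caut g psX) p
             | inr (inr p) => jet (caut g psY) p
             end].

Definition jet_group : set {ffun contact_index -> F} := range contact_jet.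

Definition jet_orbit f : set {ffun jet_index k -> F} :=
  range (fun g => jet (cact g f)).

Definition jet_stabilizer f : set {ffun contact_index -> F} :=
  [set a | exists g, a = contact_jet g /\ jet (cact g f) = jet f].

Definition orbit_map f (a : {ffun contact_index -> F})
    (b : {ffun jet_index k -> F}) :=
  exists g, a = contact_jet g /\ b = jet (cact g f).

End Jets.

Arguments jet {F} k f.
Arguments contact_jet {F} k g.
Arguments jet_group F k : clear implicits.
Arguments jet_orbit {F} k f.
Arguments jet_stabilizer {F} k f.
Arguments orbit_map {F} k f a b.

Section JetEq.
Variable F : fieldType.
Implicit Types f g : pseries F.

Let ord_ge n f := forall i j, (i + j < n)%N -> coef f i j = 0.

Let coef_sum n (u : 'I_n -> pseries F) i j :
  coef (\sum_(a < n) u a) i j = \sum_(a < n) coef (u a) i j.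
Proof.
by apply: (big_morph (fun f : pseries F => coef f i j)).
Qed.

Let ord_geM m n f g : ord_ge m f -> ord_ge n g -> ord_ge (m + n) (f * g).
Proof.
move=> f0 g0 i j ltij /=; rewrite big1 // => a _; rewrite big1 // => b _.
have [ltab|leab] := ltnP (a + b) m; first by rewrite f0 ?mul0r.
rewrite g0 ?mulr0 //; have := ltn_ord a; have := ltn_ord b; rewrite !ltnS.
move=> lebj leai; rewrite -(ltn_add2l m); apply: leq_ltn_trans ltij.
have -> : (i + j = (a + b) + ((i - a) + (j - b)))%N by rewrite addnACA !subnKC.
by rewrite leq_add2r.
Qed.

Let ord_ge_gen n (S : set (pseries F)) :
  (forall f, S f -> ord_ge n f) -> forall f, ideal_gen S f -> ord_ge n f.
Proof.
move=> ordS f [r [c [s [Ss ->]]]] i j ltij; rewrite coef_sum big1 // => a _.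
by apply: (@ord_geM 0 n) => //; apply: ordS.
Qed.

Let ord_ge_max f : maxideal f -> ord_ge 1 f.
Proof.
apply: ord_ge_gen => {}f [->|->] [|i] [|j] //.
Qed.

Let ideal_genM (R : comNzRingType) (S : set R) a b :
  ideal_gen S a -> ideal_gen S (b * a).
Proof.
move=> [n [c [s [Ss ->]]]]; exists n, (fun i => b * c i), s; split=> //.
by rewrite mulr_sumr; apply: eq_bigr => i _; rewrite mulrA.
Qed.

Let ideal_genD (R : comNzRingType) (S : set R) a b :
  ideal_gen S a -> ideal_gen S b -> ideal_gen S (a + b).
Proof.
move=> [n [c [s [Ss ->]]]] [m [d [t [St ->]]]].
exists (n + m)%N.
exists (fun i => match split i with inl j => c j | inr j => d j end).
exists (fun i => match split i with inl j => s j | inr j => t j end).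
split=> [i|]; first by case: (split i).
rewrite big_split_ord /=; congr (_ + _); apply: eq_bigr => i _.
  by rewrite -[lshift m i]/(unsplit (inl _ i)) unsplitK.
by rewrite -[rshift n i]/(unsplit (inr _ i)) unsplitK.
Qed.

Let ideal_gen_sub (R : comNzRingType) (S : set R) a : S a -> ideal_gen S a.
Proof.
by move=> Sa; exists 1%N, (fun=> 1), (fun=> a); rewrite big_ord1 mul1r.
Qed.

(* The ideal m^n consists of the series of order at least n. *)
Lemma ideal_exp_maxP n f :
  ideal_exp maxideal n f <->
  forall i j, (i + j < n)%N -> coef f i j = 0.
Proof.
elim: n f => [|n IHn] f; first by [].
split=> [|f0].
  apply: ord_ge_gen => {}f [b [c [/ord_ge_max b1 cn ->]]].
  by apply: (@ord_geM 1 n) => //; apply/IHn.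
pose g := PSeries (fun i j => coef f i.+1 j).
pose h := PSeries (fun i j => if i is 0 then coef f 0 j.+1 else 0).
have -> : f = psX * g + psY * h.
  apply: pseriesP => i j.
  have -> : coef (psX * g + psY * h) i j
          = coef (ps_mul psX g) i j + coef (ps_mul psY h) i j by [].
  rewrite !coef_monoM !subn0.
  case: i j => [|i] [|j] //=; rewrite ?subn1 /= ?addr0 ?add0r ?subn0 //.
  by rewrite f0.
apply: ideal_genD; apply: ideal_gen_sub.
- exists psX, g; split=> //; first by apply: ideal_gen_sub; left.
  by apply/IHn => i j ltij; rewrite /= f0.
- exists psY, h; split=> //; first by apply: ideal_gen_sub; right.
  by apply/IHn => -[|i] j ltij //=; rewrite f0.
Qed.

Lemma jet_eqP k f g : jet k f = jet k g <-> ideal_exp maxideal k.+1 (f - g).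
Proof.
split=> [/ffunP jfg|/ideal_exp_maxP fg0].
  apply/ideal_exp_maxP => i j; rewrite ltnS => leij /=.
  have leik := leq_trans (leq_addr j i) leij.
  have lejk := leq_trans (leq_addl i j) leij.
  pose p : 'I_k.+1 * 'I_k.+1 := (inord i, inord j).
  have pk : (p.1 + p.2 <= k)%N by rewrite /= !inordK ?ltnS.
  by have := jfg (exist _ p pk); rewrite !ffunE /= !inordK ?ltnS // => ->; rewrite subrr.
apply/ffunP => -[[i j] /= leij]; rewrite !ffunE /=.
by apply/subr0_eq/(fg0 i j).
Qed.

Lemma jet_surj k (v : {ffun jet_index k -> F}) : exists f, jet k f = v.
Proof.
exists (PSeries (fun i j =>
  if insub (inord i, inord j) is Some p then v p else 0)).
apply/ffunP => p; rewrite ffunE /= !inord_val -surjective_pairing.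
by rewrite valK.
Qed.

End JetEq.

(** * The tangent space *)

Section TangentSpace.
(* L plays the role of the algebraic closure of K: orbits are formed over L,
   and only the K-rational tangent vectors are kept. *)
Variables (K L : fieldType) (iota : {rmorphism K -> L}).
Variable f : pseries K.

Definition jet_tangent_space k : set {ffun jet_index k -> K} :=
  [set v | tangent_at (jet_orbit k (map_ps iota f)) (jet k (map_ps iota f))
             [ffun p => iota (v p)]].

Definition tangent_space : set (pseries K) :=
  [set b | forall k, @jet_tangent_space k (jet k b)].

End TangentSpace.

(* Main.v *)
Require Import Defs.
From HB Require Import structures.
From mathcomp Require Import all_boot all_order all_algebra.
From mathcomp Require Import separable.
From mathcomp Require Import boolp classical_sets.
From mathcomp Require Import mpoly.
From mathcomp Require Import ring.

Set Implicit Arguments.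
Unset Strict Implicit.
Unset Printing Implicit Defensive.

Import GRing.Theory.
Local Open Scope classical_set_scope.
Local Open Scope ring_scope.

(** In characteristic 2 the cusp f = x^2 + y^3 has df/dx = 0 and df/dy = y^2,
    so its tangent image is <x^2, xy^2, y^3>, the series without terms
    1, x, y, xy, y^2 ([cusp_tangent_image], [tangent_monomials]).  The orbit of
    f nevertheless moves in the direction y^2, since Frobenius turns
    x |-> x + sy into f |-> f + s^2 y^2, and over a perfect field s^2 is an
    arbitrary scalar: f + z y^2 is a whole line in the orbit.  Together with
    the curves U x^2 + V y^3 (units U, V) and x^2 + (y + hx)^3 this shows
    that the tangent space contains all series without terms 1, x, y, xy
    ([cusp_tangent_sub]); it contains nothing more because the 2-jet of
    u phi(f) is u(0)(a^2 x^2 + b^2 y^2), where ax + by is the linear part of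
    phi(x) ([coef_cact], [cusp_tangent_space]).

    Determinacy rests on the same normal form: a series h with h - f in m^5
    is U x^2 + V y^3 with U(0) = V(0) = 1, and y |-> y (V/U)^(1/3) carries f to
    h/U ([cusp_form_orbit]).  Cube roots exist because
    the product of all w^(4^k) inverts a cube root of w = 1 + n, the factors
    being 1 + n^(4^k) in characteristic 2 ([cube_root1]); an endomorphism of
    K[[x,y]] is an automorphism exactly when its Jacobian at the origin is
    nonzero ([automorphism_jacobian], [jacobian_bijective]).

    All dimensions are computed by one statement ([chart_dim]): a set which is
    rationally parametrized by a nonempty open set of affine n-space, with a
    polynomial left inverse, has Krull dimension n.  Coordinate slices give a
    chain of length n.  Conversely a chain of length e gives e polynomials in
    n variables, each in one prime of a chain and outside the next, hence
    algebraically independent ([prime_chain_independent]), whereas n + 1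
    polynomials in n variables are dependent by counting monomials
    ([algebraic_dependence]).  For 2-jets, the group is open in a linear space
    of dimension 16; the stabilizer is given by b = 0 and u(0) = a^-2 and has
    dimension 14; the orbit is the punctured plane of all
    alpha x^2 + beta y^2.

    For inseparability, the function b/a on the group has square beta/alpha,
    which is not a square in the function field L(alpha, beta) of the orbit
    ([square_mul_var]).  In characteristic 2 such a square root cannot be
    separable over a purely transcendental extension
    ([inseparable_square]). *)

(** * Polynomials and polynomial functions *)

Lemma mpoly_alg_ind (n : nat) (R : comNzRingType) (Q : {mpoly R[n]} -> Prop) :
  (forall c, Q c%:MP) -> (forall i, Q 'X_i) ->
  (forall p q, Q p -> Q q -> Q (p + q)) ->
  (forall p q, Q p -> Q q -> Q (p * q)) -> forall p, Q p.
Proof.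
move=> QC QX QD QM p; elim/mpolyind: p => [|c m p _ _ Qp]; first exact: (QC 0).
apply: (QD) => //; rewrite -mul_mpolyC; apply: (QM) => //.
rewrite mpolyXE_id; apply: big_ind => [||i _]; [exact: (QC 1)|exact: QM|].
elim: (m i) => [|k IHk]; first exact: (QC 1).
by rewrite exprS; apply: QM.
Qed.

Lemma closed_poly0 (L : closedFieldType) (p : {poly L}) :
  (forall z, p.[z] = 0) -> p = 0.
Proof.
move=> p0; apply/eqP; apply: contraT => /closed_nonrootP[z].
by rewrite /root p0 eqxx.
Qed.

(** By induction on the number of variables: [muni] isolates the last one, and
    a univariate polynomial with infinitely many zeros vanishes. *)
Lemma mpoly_eq0_closed (L : closedFieldType) n (P : {mpoly L[n]}) :
  (forall v, P.@[v] = 0) -> P = 0.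
Proof.
elim: n P => [|n IHn] P P0.
  have sP : (msize P <= 1)%N.
    rewrite msizeE; apply/bigmax_leqP_seq => m _ _.
    by rewrite mdegE big_ord0.
  move: (P0 (fun=> 0)); rewrite (msize1_polyC sP) mevalC => ->.
  by rewrite mpolyC0.
pose w := widen_ord (leqnSn n).
pose ev (v : 'I_n -> L) (z : L) (Q : {poly {mpoly L[n]}}) :=
  (map_poly (meval v) Q).[z].
have muniX (i : 'I_n.+1) : muni ('X_i : {mpoly L[n.+1]}) =
    if unlift ord_max i is Some j then ('X_j)%:P else 'X.
  rewrite /muni mmapX mmap1U; case: unliftP => [j ->|->]; case: splitP => k /=.
  - rewrite /bump leqNgt ltn_ord add0n => e; congr (('X__)%:P).
    exact: val_inj.
  - by rewrite /bump leqNgt ltn_ord add0n => e; have := ltn_ord j; rewrite e ltnNge leq_addr.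
  - by move=> e; have := ltn_ord k; rewrite -e ltnn.
  - by [].
have evP v z Q : ev v z (muni Q) =
    Q.@[fun i => if unlift ord_max i is Some j then v j else z].
  elim/mpoly_alg_ind: Q => [c|i|p q IHp IHq|p q IHp IHq].
  - by rewrite /ev muniC map_polyC /= hornerC !mevalC.
  - rewrite mevalXU /ev muniX; case: (unlift _ _) => [j|].
      by rewrite map_polyC /= hornerC mevalXU.
    by rewrite map_polyX hornerX.
  - by rewrite mevalD -IHp -IHq /ev muniD (raddfD (map_poly _)) hornerD.
  - rewrite mevalM -IHp -IHq /ev.
    rewrite muniM.
    rewrite (rmorphM (map_poly (meval v))).
    by rewrite hornerM.
(* P is recovered from muni P by substituting the last variable. *)
have backP Q : (map_poly (@mwiden n L) (muni Q)).['X_ord_max] = Q.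
  elim/mpoly_alg_ind: Q => [c|i|p q IHp IHq|p q IHp IHq].
  - by rewrite muniC map_polyC /= hornerC mwidenC.
  - rewrite muniX; case: unliftP => [j ->|->].
      rewrite map_polyC /= hornerC mwidenX mnmwiden1; congr 'X__.
      by apply: val_inj; rewrite /= /bump leqNgt ltn_ord.
    by rewrite map_polyX hornerX.
  - rewrite muniD.
    rewrite (raddfD (map_poly (@mwiden n L))).
    rewrite hornerD.
    rewrite -[in RHS]IHp.
    by rewrite -[in RHS]IHq.
  - rewrite muniM.
    rewrite (rmorphM (map_poly (@mwiden n L))).
    rewrite hornerM.
    rewrite -[in RHS]IHp.
    by rewrite -[in RHS]IHq.
rewrite -[P]backP; have -> : muni P = 0; last by rewrite rmorph0 horner0.
apply/polyP => k; rewrite coef0; apply: IHn => v.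
rewrite -coef_map; set p := map_poly _ _.
suff -> : p = 0 by rewrite coef0.
by apply: closed_poly0 => z; rewrite -/(ev v z (muni P)) evP.
Qed.

Section PolynomialFunctions.
Variables (L : fieldType) (J : finType).
Implicit Types (g h : {ffun J -> L} -> L) (t : {ffun J -> L}).

(** Regular functions are handled as functions, so that closure properties and
    identities can be checked pointwise. *)
Definition polyfun g := exists P : {mpoly L[#|J|]}, forall t, peval P t = g t.

Definition pvar (j : J) : {mpoly L[#|J|]} := 'X_(enum_rank j).

Lemma peval_var j t : peval (pvar j) t = t j.
Proof. by rewrite /peval mevalXU enum_rankK. Qed.

Lemma polyfun_peval P : polyfun (peval P).
Proof. by exists P. Qed.

Lemma polyfunC c : polyfun (fun=> c).
Proof. by exists c%:MP => t; rewrite /peval mevalC. Qed.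

Lemma polyfun_coord j : polyfun (fun t => t j).
Proof. by exists (pvar j) => t; rewrite peval_var. Qed.

Lemma polyfunD g h : polyfun g -> polyfun h -> polyfun (fun t => g t + h t).
Proof.
move=> [P gP] [Q hQ]; exists (P + Q) => t.
by rewrite -gP -hQ /peval mevalD.
Qed.

Lemma polyfunM g h : polyfun g -> polyfun h -> polyfun (fun t => g t * h t).
Proof.
move=> [P gP] [Q hQ]; exists (P * Q) => t.
by rewrite -gP -hQ /peval mevalM.
Qed.

Lemma polyfunB g h : polyfun g -> polyfun h -> polyfun (fun t => g t - h t).
Proof.
move=> [P gP] [Q hQ]; exists (P - Q) => t.
by rewrite -gP -hQ /peval mevalB.
Qed.

Lemma polyfunX g n : polyfun g -> polyfun (fun t => g t ^+ n).
Proof.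
move=> [P gP]; exists (P ^+ n) => t.
by rewrite -gP /peval rmorphXn.
Qed.

Lemma polyfun_ext g h : g =1 h -> polyfun g -> polyfun h.
Proof. by move=> gh [P gP]; exists P => t; rewrite gP gh. Qed.

End PolynomialFunctions.

Lemma polyfun_comp (L : fieldType) (I J : finType)
    (phi : {ffun J -> L} -> {ffun I -> L}) (g : {ffun I -> L} -> L) :
  (forall i, polyfun (fun t => phi t i)) -> polyfun g ->
  polyfun (fun t => g (phi t)).
Proof.
move=> phiP [P gP]; apply: (polyfun_ext (fun t => gP (phi t))).
elim/mpoly_alg_ind: P {gP} => [c|i|p q IHp IHq|p q IHp IHq].
- by apply: polyfun_ext (polyfunC _ c) => t; rewrite /peval mevalC.
- by apply: polyfun_ext (phiP (enum_val i)) => t; rewrite /peval mevalXU.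
- by apply: polyfun_ext (polyfunD IHp IHq) => t; rewrite /peval mevalD.
- by apply: polyfun_ext (polyfunM IHp IHq) => t; rewrite /peval mevalM.
Qed.

Section Curves.
Variables (L : fieldType) (J : finType) (c : J -> {poly L}).

Definition curve_pt (z : L) : {ffun J -> L} := [ffun j => (c j).[z]].

Definition pullback_curve (P : {mpoly L[#|J|]}) : {poly L} :=
  mmap polyC (fun i => c (enum_val i)) P.

Lemma horner_pullback P z : (pullback_curve P).[z] = peval P (curve_pt z).
Proof.
rewrite /pullback_curve /peval.
elim/mpoly_alg_ind: P => [d|i|p q IHp IHq|p q IHp IHq].
- by rewrite mmapC mevalC hornerC.
- by rewrite mmapX mmap1U mevalXU ffunE.
- by rewrite mmapD mevalD hornerD IHp IHq.
- by rewrite rmorphM mevalM hornerM IHp IHq.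
Qed.

Lemma deriv_pullback P :
  (pullback_curve P)^`() =
  \sum_(i < #|J|) pullback_curve (P^`M(i)) * (c (enum_val i))^`().
Proof.
rewrite /pullback_curve.
elim/mpoly_alg_ind: P => [d|i|p q IHp IHq|p q IHp IHq].
- rewrite mmapC derivC big1 // => i _.
  by rewrite mderivC rmorph0 mul0r.
- rewrite mmapX mmap1U (bigD1 i) //= big1 ?addr0 => [|j ji].
    have U0 : (U_(i) - U_(i) = 0 :> 'X_{1..#|J|})%MM.
      by apply/mnmP => k; rewrite !mnmE subnn.
    by rewrite mderivX mnm1E eqxx scale1r U0 mpolyX0 rmorph1 mul1r.
  by rewrite mderivX mnm1E eq_sym (negPf ji) scale0r rmorph0 mul0r.
- rewrite mmapD derivD IHp IHq -big_split; apply: eq_bigr => i _ /=.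
  by rewrite mderivD mmapD mulrDl.
- rewrite rmorphM derivM IHp IHq mulr_suml mulr_sumr -big_split.
  apply: eq_bigr => i _ /=; rewrite mderivM rmorphD !rmorphM /=; ring.
Qed.

End Curves.

Lemma polyfun_domain (L : closedFieldType) (J : finType)
    (g h : {ffun J -> L} -> L) :
  polyfun g -> polyfun h -> (forall t, g t * h t = 0) ->
  (forall t, g t = 0) \/ (forall t, h t = 0).
Proof.
move=> [P gP] [Q hQ] gh0.
have PQ0 : P * Q = 0.
  apply: mpoly_eq0_closed => v.
  have -> : v = fun i => [ffun j : J => v (enum_rank j)] (enum_val i).
    by apply/funext => i; rewrite ffunE enum_valK.
  by rewrite mevalM -/(peval P _) -/(peval Q _) gP hQ.
move/eqP: PQ0; rewrite mulf_eq0 => /orP[]/eqP e; [left|right] => t.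
  by rewrite -gP e /peval meval0.
by rewrite -hQ e /peval meval0.
Qed.

Lemma peval_eq0_closed (L : closedFieldType) (J : finType)
  (P : {mpoly L[#|J|]}) : (forall t, peval P t = 0) -> P = 0.
Proof.
move=> P0; apply: mpoly_eq0_closed => v.
rewrite -[RHS](P0 [ffun j : J => v (enum_rank j)]) /peval.
by apply: meval_eq => i; rewrite ffunE enum_valK.
Qed.

(** * Algebraic independence along chains of primes *)

Lemma msize_expM_le (L : fieldType) n (p q : {mpoly L[n]}) d d' :
  (msize p <= d.+1)%N -> (msize q <= d'.+1)%N -> (msize (p * q) <= (d + d').+1)%N.
Proof.
move=> pd qd; have [->|p0] := eqVneq p 0; first by rewrite mul0r msize0.
have [->|q0] := eqVneq q 0; first by rewrite mulr0 msize0.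
rewrite msizeM // -subn1 leq_subLR add1n -addSn -addnS.
exact: leq_add.
Qed.

(** Counting: the M^e monomials of degree below M in each of the g i lie in the
    space spanned by the (C M)^n monomials of degree below C M in each
    variable, where C depends only on e and on the degrees of the g i.  For
    n < e and M > C^n there are too many of them to be independent. *)
Lemma algebraic_dependence (L : fieldType) n e (g : 'I_e -> {mpoly L[n]}) :
  (n < e)%N ->
  exists M (c : {ffun 'I_e -> 'I_M} -> L),
    (exists a, c a != 0) /\ \sum_a c a *: \prod_i g i ^+ a i = 0.
Proof.
move=> ltne; pose D := (\max_(i < e) msize (g i))%N.
have gD i : (msize (g i) <= D.+1)%N by apply/leqW/(leq_bigmax i).
pose C := (e * D).+1; pose M := (C ^ n).+1; pose B := (C * M)%N.
pose mon (a : {ffun 'I_e -> 'I_M}) := \prod_i g i ^+ a i.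
have expD k i : (msize (g i ^+ k) <= (k * D).+1)%N.
  elim: k => [|k IHk]; first by rewrite expr0 msize1.
  by rewrite exprS mulSn; apply: msize_expM_le.
have monB a : (msize (mon a) <= B)%N.
  have le1 : (msize (mon a) <= (\sum_(i < e) a i * D).+1)%N.
    rewrite /mon; elim/big_ind2: _ => [|p d q d' pd qd|i _] //.
      by rewrite msize1.
    exact: msize_expM_le.
  apply: leq_trans le1 _; rewrite /B /C mulSn -addn1 addnC leq_add //.
  rewrite -mulnA (mulnC D) -[X in (_ <= X * _)%N]card_ord -sum_nat_const.
  by apply: leq_sum => i _; rewrite leq_mul2r ltnW ?orbT.
pose T1 := {ffun 'I_e -> 'I_M}; pose T2 := {ffun 'I_n -> 'I_B}.
pose A : 'M[L]_(#|T1|, #|T2|) :=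
  \matrix_(i, j) (mon (enum_val i))@_[multinom (enum_val j : T2) k : nat | k < n].
have ltT : (#|T2| < #|T1|)%N.
  rewrite !card_ffun !card_ord /B expnMn.
  apply: (@leq_trans (M * M ^ n)); last by rewrite -expnS leq_pexp2l.
  by rewrite ltn_pmul2r // expn_gt0.
(* Row a of A lists the coefficients of the monomial with exponents a. *)
have : kermx A != 0.
  rewrite -mxrank_eq0 mxrank_ker subn_eq0 -ltnNge.
  exact: leq_ltn_trans (rank_leq_col A) ltT.
case/rowV0Pn => v /sub_kermxP vA /eqP v0.
exists M, (fun a => v 0 (enum_rank a)); split.
  apply/not_existsP => c0; apply: v0; apply/rowP => i; rewrite mxE.
  by apply/eqP; have /negP := c0 (enum_val i); rewrite enum_valK negbK.
apply/mpolyP => m; rewrite mcoeff0 raddf_sum /=.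
have [mB|/existsPn mB] := boolP [exists i, B <= m i]%N.
  rewrite big1 // => a _; rewrite mcoeffZ; case/existsP: mB => i mB.
  have /memN_msupp_eq0 -> : m \notin msupp (mon a); last by rewrite mulr0.
  apply: msize_mdeg_ge; apply: leq_trans (monB a) (leq_trans mB _).
  by rewrite mdegE (bigD1 i) //= leq_addr.
have {}mB i : (m i < B)%N by rewrite ltnNge.
pose b : T2 := [ffun i => Ordinal (mB i)].
move/rowP/(_ (enum_rank b)): vA; rewrite !mxE => vA0; rewrite -[RHS]vA0.
rewrite (reindex (@enum_val T1 predT)) /=; last exact/onW_bij/enum_val_bij.
apply: eq_bigr => i _; rewrite mcoeffZ enum_valK mxE enum_rankK; congr (_ * _@__).
by apply/mnmP => k; rewrite mnmE ffunE.
Qed.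

Definition prime_ideal (R : comNzRingType) (P : set R) :=
  [/\ P 0 /\ ~ P 1, forall a b, P a -> P b -> P (a + b),
      forall a b, P b -> P (a * b) & forall a b, P (a * b) -> P a \/ P b].

Section PrimeChain.
Variables (L : fieldType) (R : comAlgType L) (e : nat).
Variables (J : nat -> set R) (g : 'I_e -> R).
Hypothesis primeJ : forall i, (i <= e)%N -> prime_ideal (J i).
Hypothesis decrJ : forall i, (i < e)%N -> J i.+1 `<=` J i.
Hypothesis gJ : forall i : 'I_e, J i (g i).
Hypothesis gNJ : forall i : 'I_e, ~ J i.+1 (g i).

(** Descending along the chain, the monomials in A that still matter are those
    agreeing on the exponents of g k, g (k+1), and so on.  Modulo J k.+1 the least
    power of g k can be divided out, as J k.+1 is prime; modulo J k only the
    monomials with that least exponent survive, as g k is in J k.  When all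
    exponents are exhausted a single nonzero constant is left in J 0. *)
Lemma prime_chain_independent_aux M (c : {ffun 'I_e -> 'I_M} -> L) k
    (A : {set {ffun 'I_e -> 'I_M}}) : (k <= e)%N -> A != finset.set0 ->
  (forall a, a \in A -> c a != 0) ->
  (forall a b (i : 'I_e), a \in A -> b \in A -> (k <= i)%N -> a i = b i) ->
  ~ J k (\sum_(a in A) c a *: \prod_(i < e | (i < k)%N) g i ^+ a i).
Proof.
elim: k A => [|k IHk] A lek /set0Pn[a0 Aa0] c0 eqA.
  have -> : A = [set a0]%SET.
    apply/setP => b; rewrite !inE; apply/idP/eqP => [Ab|->//].
    by apply/ffunP => i; apply: eqA.
  rewrite big_set1 big_pred0 // => Jc.
  have [[_ J1] _ JM _] := primeJ (leq0n e).
  apply: J1; have := JM ((c a0)^-1 *: 1) _ Jc.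
  by rewrite -scalerAl mul1r scalerA mulVf ?scale1r ?c0.
pose ik : 'I_e := Ordinal lek.
case: (arg_minnP (fun a : {ffun 'I_e -> 'I_M} => a ik : nat) Aa0) => a1 Aa1 a1min.
pose mu : nat := a1 ik.
pose A1 := [set a in A | a ik == mu :> nat]%SET.
pose r (a : {ffun 'I_e -> 'I_M}) : R := \prod_(i < e | (i < k)%N) g i ^+ a i.
have prodE (a : {ffun 'I_e -> 'I_M}) :
    \prod_(i < e | (i < k.+1)%N) g i ^+ a i = g ik ^+ a ik * r a.
  rewrite (bigD1 ik) //=; congr (_ * _); apply: eq_bigl => i.
  by rewrite ltnS ltn_neqAle andbC.
(* The least power of g k is factored out of the whole sum. *)
have sumE : \sum_(a in A) c a *: \prod_(i < e | (i < k.+1)%N) g i ^+ a i =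
    g ik ^+ mu * (\sum_(a in A1) c a *: r a +
      g ik * \sum_(a in (A :\: A1)%SET) c a *: (g ik ^+ (a ik - mu).-1 * r a)).
  rewrite (big_setID A1) /= mulrDr !mulr_sumr; congr (_ + _).
    have -> : (A :&: A1 = A1)%SET by apply/finset.setIidPr/fintype.subsetP => a; rewrite inE => /andP[].
    apply: eq_bigr => a; rewrite inE => /andP[_ /eqP amu].
    by rewrite prodE amu scalerAr.
  apply: eq_bigr => a; rewrite !inE => /andP[/nandP nA1 Aa].
  have ltmu : (mu < a ik)%N.
    by rewrite ltn_neqAle a1min // andbT eq_sym; case: nA1 => // /negP.
  have e1 : (a ik = mu + (a ik - mu).-1.+1 :> nat)%N.
    by rewrite prednK ?subn_gt0 // subnKC // ltnW.
  by rewrite prodE {1}e1 exprD exprS -!scalerAr !mulrA.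
rewrite sumE; have [[_ J1] JD JM Jprime] := primeJ lek.
have Jexp n : ~ J k.+1 (g ik ^+ n).
  elim: n => [|n IHn]; first by rewrite expr0.
  by rewrite exprS => /Jprime[] //; apply: (gNJ (i := ik)).
move=> /Jprime[/Jexp //|] /(decrJ lek).
have [_ JDk JMk _] := primeJ (ltnW lek).
set s1 := \sum_(a in A1) _; set s2 := \sum_(a in _) _ => Js.
apply: (IHk A1) => //.
- exact: ltnW.
- by apply/set0Pn; exists a1; rewrite inE eqxx andbT.
- by move=> a; rewrite inE => /andP[/c0].
- move=> a b i; rewrite !inE => /andP[Aa /eqP amu] /andP[Ab /eqP bmu].
  rewrite leq_eqVlt => /orP[/eqP ki|]; last exact: eqA.
  have -> : i = ik by apply: val_inj.
  by apply: val_inj; rewrite /= amu bmu.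
rewrite -/s1 -(addrK (g ik * s2) s1); apply: JDk => //.
by rewrite [g ik * _]mulrC -mulNr; apply: JMk; apply: (gJ ik).
Qed.

Lemma prime_chain_independent M (c : {ffun 'I_e -> 'I_M} -> L) :
  (exists a, c a != 0) -> \sum_a c a *: \prod_i g i ^+ a i <> 0.
Proof.
move=> [a ca0] sum0; pose A := [set a | c a != 0]%SET.
apply: (@prime_chain_independent_aux M c e A) => //.
- by apply/set0Pn; exists a; rewrite inE.
- by move=> b; rewrite inE.
- by move=> b b' i _ _; rewrite leqNgt ltn_ord.
have -> : \sum_(a in A) c a *: \prod_(i < e | (i < e)%N) g i ^+ a i = 0.
  rewrite -[RHS]sum0 [RHS](bigID (mem A)) /= [X in _ + X]big1 ?addr0.
    apply: eq_bigr => b _; congr (_ *: _); apply: eq_bigl => i.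
    by rewrite ltn_ord.
  by move=> b; rewrite inE negbK => /eqP ->; rewrite scale0r.
by have [[]] := primeJ (leqnn e).
Qed.

End PrimeChain.

(** * Dimension of rationally parametrized sets *)

Section Irreducible.
Variables (L : fieldType) (I : finType).
Implicit Types Z : set {ffun I -> L}.

(** If neither of two closed sets contains Z, then neither factor of the
    product of two equations, one for each of them, vanishes on Z. *)
Lemma irreducible_setP Z :
  irreducible_set Z <->
  Z !=set0 /\
  forall P Q : {mpoly L[#|I|]},
    (forall a, Z a -> peval P a * peval Q a = 0) ->
    (forall a, Z a -> peval P a = 0) \/ (forall a, Z a -> peval Q a = 0).
Proof.
split=> -[Z0 irrZ]; split=> //.
  move=> P Q PQ0.
  pose V (T : {mpoly L[#|I|]}) := Z `&` [set a | peval T a = 0].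
  have clV T : closed_in Z (V T).
    exists [set T]; apply/seteqP; split=> a [Za Ta]; split=> //.
      by move=> _ ->.
    exact: Ta.
  have [|ZP|ZQ] := irrZ _ _ (clV P) (clV Q).
  - apply/seteqP; split=> [a Za|a [] []//].
    have /eqP := PQ0 _ Za; rewrite mulf_eq0 => /orP[]/eqP; first by left.
    by right.
  - by left => a; rewrite ZP => -[].
  - by right => a; rewrite ZQ => -[].
move=> _ _ [S1 ->] [S2 ->] ZU.
apply: contrapT => /not_orP[N1 N2].
have out S : ~ Z = Z `&` [set a | forall P, S P -> peval P a = 0] ->
    exists P a, [/\ S P, Z a & peval P a <> 0].
  move=> NZ; apply: contrapT => NP; apply: NZ; apply/seteqP; split=> [a Za|a []//].
  split=> // P SP; apply: contrapT => Pa; apply: NP.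
  by exists P, a.
have [P1 [a1 [SP1 Za1 Pa1]]] := out _ N1.
have [P2 [a2 [SP2 Za2 Pa2]]] := out _ N2.
have [|P10|P20] := irrZ P1 P2.
- move=> a; rewrite ZU => -[] [Za aS].
    by rewrite (aS _ SP1) mul0r.
  by rewrite (aS _ SP2) mulr0.
- exact/Pa1/P10.
- exact/Pa2/P20.
Qed.

End Irreducible.

Section Chart.
Variables (L : closedFieldType) (I J : finType).
Variables (X : set {ffun I -> L}) (U : set {ffun J -> L}).
Variables (phi : {ffun J -> L} -> {ffun I -> L}) (psi : {ffun I -> L} -> {ffun J -> L}).
Variables (D E : {ffun J -> L} -> L) (p : {ffun J -> L}).

(** X is the image of U under phi, a map whose coordinates become polynomials
    after multiplication by D, with polynomial left inverse psi.  The open set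
    where E does not vanish contains the base point p and lies in U; it
    makes U dense. *)
Record rational_chart : Prop := RationalChart {
  chart_image : X = phi @` U;
  chart_inverse : forall j, polyfun (fun a => psi a j);
  chartK : forall t, U t -> psi (phi t) = t;
  chart_denom : polyfun D;
  chart_denom_neq0 : forall t, U t -> D t != 0;
  chart_rational : forall i, exists2 q, polyfun q & forall t, U t -> phi t i * D t = q t;
  chart_open : polyfun E;
  chart_base : E p != 0;
  chart_openP : forall t, E t != 0 -> U t
}.

Hypothesis chartX : rational_chart.

Lemma chart_dense g : polyfun g -> (forall t, U t -> g t = 0) -> forall t, g t = 0.
Proof.
move=> gP g0; case: (polyfun_domain (chart_open chartX) gP) => // [t|E0].
  have [->|/(chart_openP chartX)/g0 ->] := eqVneq (E t) 0; first by rewrite mul0r.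
  by rewrite mulr0.
by have := chart_base chartX; rewrite E0 eqxx.
Qed.

(** A polynomial on X pulls back to a fraction with denominator a power of D. *)
Lemma chart_pullback P : exists2 q, polyfun q &
  exists n, forall t, U t -> peval P (phi t) * D t ^+ n = q t.
Proof.
rewrite /peval; elim/mpoly_alg_ind: P => [c|i|P Q IHP IHQ|P Q IHP IHQ].
- exists (fun=> c); first exact: polyfunC.
  by exists 0%N => t _; rewrite mevalC mulr1.
- have [q qP qE] := chart_rational chartX (enum_val i).
  by exists q => //; exists 1%N => t Ut; rewrite mevalXU -qE.
- have [[q qP [n qE]] [r rP [m rE]]] := (IHP, IHQ).
  have DP := chart_denom chartX.
  exists (fun t => q t * D t ^+ m + r t * D t ^+ n).
    by apply: polyfunD; apply: polyfunM => //; apply: polyfunX.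
  exists (n + m)%N => t Ut; rewrite mevalD -qE // -rE // exprD; ring.
- have [[q qP [n qE]] [r rP [m rE]]] := (IHP, IHQ).
  exists (fun t => q t * r t); first exact: polyfunM.
  exists (n + m)%N => t Ut; rewrite mevalM -qE // -rE // exprD; ring.
Qed.

(** The ideals of polynomials Q in the parameters with Q o psi vanishing on C i
    are prime and strictly decreasing: an equation of C i violated somewhere on
    C i.+1 pulls back, up to a power of D, to a member of one ideal that is
    not in the next. *)
Lemma chart_dim_le e C : irred_chain X e C -> (e <= #|J|)%N.
Proof.
move=> [Ccl Clt]; rewrite leqNgt; apply/negP => ltJe.
pose V i := [set Q : {mpoly L[#|J|]} | forall a, C i a -> peval Q (psi a) = 0].
have primeV i : (i <= e)%N -> prime_ideal (V i).
  move=> lei; have [_ /irreducible_setP[[a0 Ca0] irrC]] := Ccl i lei.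
  split; rewrite /V /=.
  - split=> [a _|/(_ _ Ca0)]; rewrite /peval ?meval0 // meval1.
    by move/eqP; rewrite oner_eq0.
  - by move=> P Q P0 Q0 a Ca; rewrite /peval mevalD [X in X + _]P0 // [X in _ + X]Q0 ?addr0.
  - by move=> P Q Q0 a Ca; rewrite /peval mevalM [X in _ * X]Q0 // mulr0.
  move=> P Q PQ0.
  have [P' P'E] := polyfun_comp (chart_inverse chartX) (polyfun_peval P).
  have [Q' Q'E] := polyfun_comp (chart_inverse chartX) (polyfun_peval Q).
  have [|P0|Q0] := irrC P' Q'.
  - move=> a Ca; rewrite P'E Q'E -[RHS](PQ0 _ Ca) /peval.
    by rewrite mevalM.
  - by left => a Ca; rewrite -P'E P0.
  - by right => a Ca; rewrite -Q'E Q0.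
have decrV i : (i < e)%N -> V i.+1 `<=` V i.
  by move=> lti Q Q0 a Ca; apply: Q0; apply: (properW (Clt i lti)).
have sepV (i : 'I_e) : exists Q, V i Q /\ ~ V i.+1 Q.
  have [[S CE] _] := Ccl i (ltnW (ltn_ord i)).
  have [[S' CE'] _] := Ccl i.+1 (ltn_ord i).
  have [_ /nonsubset[a [Ca' NCa]]] := Clt i (ltn_ord i).
  have Xa : X a by move: Ca'; rewrite CE' => -[].
  have [P [SP Pa]] : exists P, S P /\ peval P a <> 0.
    apply: contrapT => NP; apply: NCa; rewrite CE; split=> // P SP.
    by apply: contrapT => Pa; apply: NP; exists P.
  have [q [Q QE] [n qE]] := chart_pullback P.
  exists Q; split=> [b Cb|Q0].
    have : X b by move: Cb; rewrite CE => -[].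
    rewrite (chart_image chartX) => -[t Ut tb]; rewrite -tb (chartK chartX) //.
    rewrite QE -qE // tb; move: Cb; rewrite CE => -[_ /(_ _ SP) ->].
    by rewrite mul0r.
  move: (Q0 a Ca'); move: Xa; rewrite (chart_image chartX) => -[t Ut ta].
  rewrite -ta (chartK chartX) // QE -qE // ta => /eqP.
  rewrite mulf_eq0 expf_eq0 (negPf (chart_denom_neq0 chartX Ut)) andbF orbF.
  by move/eqP.
have [g gV] := choice sepV.
have [M [c [c0 /eqP dep]]] := algebraic_dependence g ltJe.
have := @prime_chain_independent L {mpoly L[#|J|]} e V g primeV decrV.
move=> /(_ (fun i => (gV i).1) (fun i => (gV i).2) M c c0).
by move/eqP: dep.
Qed.

Let flat j (t : {ffun J -> L}) : {ffun J -> L} :=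
  [ffun k => if (enum_rank k < j)%N then t k else p k].

Let flatP j g : polyfun g -> polyfun (fun t => g (flat j t)).
Proof.
apply: polyfun_comp => k; case: (ltnP (enum_rank k) j) => lt.
  by apply: polyfun_ext (polyfun_coord L k) => t; rewrite ffunE lt.
by apply: polyfun_ext (polyfunC J (p k)) => t; rewrite ffunE ltnNge lt.
Qed.

Let flat_base j : flat j p = p.
Proof. by apply/ffunP => k; rewrite ffunE if_same. Qed.

Let flat_idem j t : flat j (flat j t) = flat j t.
Proof. by apply/ffunP => k; rewrite !ffunE; case: (enum_rank k < j)%N. Qed.

Let slice j := phi @` (U `&` [set t | flat j t = t]).

Let slice_irreducible j : irreducible_set (slice j).
Proof.
apply/irreducible_setP; split.
  exists (phi p); exists p => //; split; last exact: flat_base.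
  exact/(chart_openP chartX)/(chart_base chartX).
move=> P1 P2 P0.
have [q1 q1P [n1 q1E]] := chart_pullback P1.
have [q2 q2P [n2 q2E]] := chart_pullback P2.
have EP := flatP j (chart_open chartX).
have [t|E0|q0] := polyfun_domain EP (polyfunM (flatP j q1P) (flatP j q2P)).
- have [->|/(chart_openP chartX) Ut] := eqVneq (E (flat j t)) 0; first by rewrite mul0r.
  rewrite -q1E // -q2E // mulrACA P0 ?mul0r ?mulr0 //.
  by exists (flat j t); split=> //; apply: flat_idem.
- by have := chart_base chartX; have := E0 p; rewrite flat_base => ->; rewrite eqxx.
have vanish P q n : (forall t, U t -> peval P (phi t) * D t ^+ n = q t) ->
    (forall t, q (flat j t) = 0) -> forall a, slice j a -> peval P a = 0.
  move=> qE q0' _ [t [Ut ft] <-]; apply/eqP; have /eqP := q0' t.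
  rewrite ft -qE // mulf_eq0 expf_eq0 (negPf (chart_denom_neq0 chartX Ut)).
  by rewrite andbF orbF.
have [||] := polyfun_domain (flatP j q1P) (flatP j q2P) => // q0'.
- by left; apply: vanish q1E q0'.
- by right; apply: vanish q2E q0'.
Qed.

Let slice_closed j : closed_in X (slice j).
Proof.
exists [set P | exists2 k, (j <= enum_rank k)%N & forall a, peval P a = psi a k - p k].
rewrite (chart_image chartX); apply/seteqP; split=> [_ [t [Ut ft] <-]|].
  split=> [|P [k jk ->]]; first by exists t.
  by rewrite (chartK chartX) // -ft ffunE ltnNge jk subrr.
move=> _ [[t Ut <-] tS]; exists t => //; split=> //=.
apply/ffunP => k; rewrite ffunE; case: ltnP => // jk.
have [P PE] := polyfunB (chart_inverse chartX k) (polyfunC I (p k)).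
have := tS P; rewrite /= PE (chartK chartX) // => tk.
by apply/esym/subr0_eq/tk; exists k.
Qed.

Let slice_lt j : (j < #|J|)%N -> slice j `<` slice j.+1.
Proof.
move=> ltj; split=> [_ [t [Ut ft] <-]|sub].
  exists t => //; split=> //=; apply/ffunP => k; rewrite ffunE.
  by case: ltnP => // jk; rewrite -[in RHS]ft ffunE ltnNge (ltnW jk).
pose k := enum_val (Ordinal ltj).
have rk : enum_rank k = j :> nat by rewrite enum_valK.
have [|E0|k0] :=
    polyfun_domain (flatP j.+1 (chart_open chartX))
                   (polyfunB (polyfun_coord L k) (polyfunC J (p k))).
- move=> t; apply/eqP; rewrite mulf_eq0 orbC; apply/contraT => /norP[tk Et].
  have : slice j.+1 (phi (flat j.+1 t)).
    exists (flat j.+1 t) => //; split; last exact: flat_idem.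
    exact: (chart_openP chartX).
  case/sub => s [Us fs] /(congr1 psi).
  rewrite !(chartK chartX) //; last exact: (chart_openP chartX).
  move=> /ffunP/(_ k); rewrite -fs !ffunE rk ltnn ltnSn => pk.
  by rewrite -pk subrr eqxx in tk.
- by have := chart_base chartX; have := E0 p; rewrite flat_base => ->; rewrite eqxx.
have /eqP := k0 [ffun=> p k + 1].
by rewrite ffunE addrAC subrr add0r oner_eq0.
Qed.

(** The chain reaching the upper bound consists of the images of the flats
    through p parallel to the first j coordinate axes. *)
Theorem chart_dim : has_dim X #|J|.
Proof.
split; last exact: chart_dim_le.
by exists slice; split=> [j _|j]; [split|exact: slice_lt].
Qed.

End Chart.

(** * Tangent vectors, function fields and inseparability *)

(** A polynomial vanishing on X vanishes identically along a curve that lies in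
    X for almost all parameters, hence so does its derivative. *)
Lemma tangent_at_curve (L : closedFieldType) (I : finType)
    (X : set {ffun I -> L}) (c : I -> {poly L}) (r : {poly L}) :
  r != 0 -> (forall z, r.[z] != 0 -> X (curve_pt c z)) ->
  tangent_at X (curve_pt c 0) [ffun i => (c i)^`().[0]].
Proof.
move=> r0 cX P PX.
have P0 : pullback_curve c P = 0.
  apply/eqP; rewrite -(mulIr_eq0 _ (mulIf r0)); apply/eqP/closed_poly0 => z.
  rewrite hornerM horner_pullback; have [->|/cX/PX ->] := eqVneq r.[z] 0.
    exact: mulr0.
  exact: mul0r.
have := deriv_pullback c P; rewrite P0 deriv0 => /(congr1 (horner_eval 0)).
rewrite /horner_eval horner0 horner_sum => e; rewrite [RHS]e.
by apply: eq_bigr => i _; rewrite hornerM horner_pullback ffunE.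
Qed.

Lemma tangent_at_comb (L : fieldType) (I : finType)
    (X : set {ffun I -> L}) a (u v w : {ffun I -> L}) (k : L) :
  tangent_at X a u -> tangent_at X a v -> (forall i, w i = u i + k * v i) ->
  tangent_at X a w.
Proof.
move=> uX vX wE P PX; transitivity (\sum_i peval (P^`M(i)) a * u (enum_val i) +
              k * \sum_i peval (P^`M(i)) a * v (enum_val i)).
  rewrite mulr_sumr -big_split; apply: eq_bigr => i _ /=.
  by rewrite wE mulrDr mulrCA.
by rewrite uX // vX // mulr0 addr0.
Qed.

(** Write a separable polynomial q with root e as q0(T^2) + T q1(T^2).  Then
    e = - q0(h c) / q1(h c), where q1(h c) = q'(e) is not 0; so e lies in the
    field F(z) containing the coefficients of q.  As z is algebraically
    independent, P^2 = c Q^2 holds for polynomials P, Q over F with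
    e = P(z)/Q(z), and comparing leading coefficients makes c a square. *)
Lemma inseparable_square (F E : fieldType) (h : {rmorphism F -> E}) (c : F) (e : E) :
  2%N \in [pchar E] -> e ^+ 2 = h c -> (forall d, d ^+ 2 <> c) ->
  ~ separable_extension h.
Proof.
move=> char2 ec nsq [n [z [alg sep]]].
have [q [qF qsep qe]] := sep e.
pose S x := exists P Q : {mpoly F[n]},
  mmap h z Q != 0 /\ x = mmap h z P / mmap h z Q.
have SC a : S (h a).
  by exists a%:MP, 1; rewrite !rmorph1 oner_eq0 mmapC divr1.
have SD x y : S x -> S y -> S (x + y).
  move=> [P [Q [Q0 ->]]] [P' [Q' [Q'0 ->]]].
  exists (P * Q' + P' * Q), (Q * Q').
  by rewrite mmapD !rmorphM mulf_neq0 ?addf_div.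
have SM x y : S x -> S y -> S (x * y).
  move=> [P [Q [Q0 ->]]] [P' [Q' [Q'0 ->]]].
  by exists (P * P'), (Q * Q'); rewrite !rmorphM mulf_neq0 ?mulf_div.
have SV x : S x -> S x^-1.
  move=> [P [Q [Q0 ->]]]; have [P0|P0] := eqVneq (mmap h z P) 0.
    by rewrite P0 mul0r invr0; have := SC 0; rewrite rmorph0.
  by exists Q, P; rewrite invf_div.
have Shorner (p : {poly E}) : (forall i, S p`_i) -> S p.[h c].
  move=> pS; rewrite horner_coef; apply: big_ind => [|x y|i _].
  - by have := SC 0; rewrite rmorph0.
  - exact: SD.
  - by rewrite -rmorphXn; apply: SM.
have qE := poly_even_odd q.
have dX2 : ('X^2 : {poly E})^`() = 0.
  by rewrite derivXn -mulr_natl -polyC_natr (pcharf0 char2) mul0r.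
have qe0 : (even_poly q).[h c] + (odd_poly q).[h c] * e = 0.
  move: qe; rewrite /root -{1}qE hornerD hornerM !horner_comp hornerXn hornerX ec.
  by move/eqP.
have dq : q^`().[e] = (odd_poly q).[h c].
  rewrite -[in LHS]qE derivD derivM !deriv_comp dX2 !mulr0 mul0r !add0r derivX mulr1.
  by rewrite horner_comp hornerXn ec.
have odd0 : (odd_poly q).[h c] != 0.
  by rewrite -dq (coprimep_root _ qe) //; move: qsep; rewrite separable_poly.unlock.
have [P [Q [Q0 eE]]] : S e.
  have -> : e = h (-1) * ((even_poly q).[h c] * (odd_poly q).[h c]^-1).
    apply: (mulIf odd0); rewrite rmorphN rmorph1 -mulrA divfK // mulN1r mulrC.
    by apply/eqP; rewrite -addr_eq0 addrC qe0.
  apply: (SM); first exact: SC.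
  apply: (SM); last apply: (SV); apply: Shorner => i.
    by rewrite coef_even_poly.
  by rewrite coef_odd_poly.
have PQ : P ^+ 2 = c *: Q ^+ 2.
  apply/eqP; rewrite -subr_eq0; apply/eqP/alg.
  rewrite mmapB mmapZ !rmorphXn /= -ec eE expr_div_n divfK ?subrr //.
  by rewrite expf_neq0.
have QN0 : Q != 0 by apply: contraNneq Q0 => ->; rewrite rmorph0.
have c0 : c != 0 by apply/eqP => c0; apply: (nsq 0); rewrite expr0n c0.
have lQ0 : mleadc Q != 0 by rewrite mleadc_eq0.
have PN0 : P != 0.
  apply: contraTneq (c0) => P0; move/eqP: PQ; rewrite P0 expr0n eq_sym.
  by rewrite scaler_eq0 expf_eq0 (negPf QN0) orbF negbK.
apply: (nsq (mleadc P / mleadc Q)); rewrite expr_div_n -!mleadcX -!mleadX // PQ.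
by rewrite mleadZ // mcoeffZ mulfK // mleadX // mleadcX expf_neq0.
Qed.

Lemma fraction_numden (R : idomainType) (x : {fraction R}) :
  exists n d, d != 0 /\ x = FracField.tofrac n / FracField.tofrac d.
Proof.
elim/quotW: x => x; exists (\n_x), (\d_x).
have d0 := denom_ratioP x; split=> //.
apply: canRL (mulfK _) _; first by rewrite tofrac_eq0.
unlock FracField.tofrac; rewrite -[LHS]FracField.pi_mul.
apply/eqmodP; rewrite /= FracField.equivfE /FracField.mulf /=.
by rewrite !numden_Ratio ?mulf_neq0 ?oner_neq0 // !mulr1 mulrC.
Qed.

Section FunctionFields.
Variables (L : closedFieldType) (I J : finType).
Variables (X : set {ffun I -> L}) (U : set {ffun J -> L}).
Variables (phi : {ffun J -> L} -> {ffun I -> L}) (psi : {ffun I -> L} -> {ffun J -> L}).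
Variables (D E : {ffun J -> L} -> L) (p : {ffun J -> L}).
Hypothesis chartX : rational_chart X U phi psi D E p.
Hypothesis phiP : forall i, polyfun (fun t => phi t i).

Lemma mpoly_polyfun_ext (P Q : {mpoly L[#|J|]}) :
  (forall t, peval P t = peval Q t) -> P = Q.
Proof.
move=> PQ; apply/eqP; rewrite -subr_eq0; apply/eqP/peval_eq0_closed => t.
by have := PQ t; rewrite /peval mevalB => ->; rewrite subrr.
Qed.

Lemma chart_function_field :
  exists ev : {rmorphism {mpoly L[#|I|]} -> {fraction {mpoly L[#|J|]}}},
    function_field X ev.
Proof.
have [f fE] := choice phiP.
pose lq := [tuple f (enum_val i) | i < #|I|].
have lqE P t : peval (P \mPo lq) t = peval P (phi t).
  rewrite /peval comp_mpoly_meval; apply: meval_eq => i.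
  by rewrite tnth_mktuple -fE.
exists (@FracField.tofrac {mpoly L[#|J|]} \o comp_mpoly lq); split=> /=.
  move=> P; split=> [/eqP|P0].
    rewrite tofrac_eq0 => /eqP P0 a; rewrite (chart_image chartX) => -[t _ <-].
    by rewrite -lqE P0 /peval meval0.
  apply/eqP; rewrite tofrac_eq0; apply/eqP/peval_eq0_closed.
  apply: (chart_dense chartX); first exact: polyfun_peval.
  move=> t Ut; rewrite lqE; apply: P0; rewrite (chart_image chartX).
  by exists t.
(* Composing with psi shows that phi is surjective on coordinate rings. *)
have lift Q : exists P, P \mPo lq = Q.
  have [P PE] := polyfun_comp (chart_inverse chartX) (polyfun_peval Q).
  exists P; apply: mpoly_polyfun_ext => t; apply: subr0_eq; move: t.
  apply: (chart_dense chartX).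
    by apply: polyfunB; apply: polyfun_peval.
  by move=> t Ut; rewrite lqE PE (chartK chartX) // subrr.
move=> e; have [n [d [d0 ->]]] := fraction_numden e.
have [[P PE] [Q QE]] := (lift n, lift d).
by exists P, Q; rewrite /= PE QE tofrac_eq0.
Qed.

End FunctionFields.

Lemma subf_div (F : fieldType) (x y z t : F) :
  y != 0 -> t != 0 -> x / y - z / t = (x * t - z * y) / (y * t).
Proof. by move=> y0 t0; rewrite -mulNr addf_div // mulNr. Qed.

Section FunctionFieldMorphism.
Variables (L : fieldType) (I J : finType).
Variables (X : set {ffun I -> L}) (Y : set {ffun J -> L}) (E F : fieldType).
Variables (evX : {rmorphism {mpoly L[#|I|]} -> E}) (evY : {rmorphism {mpoly L[#|J|]} -> F}).
Hypotheses (ffX : function_field X evX) (ffY : function_field Y evY).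

(** A morphism of coordinate rings that reflects vanishing is injective on the
    quotient domains and therefore extends to their fraction fields. *)
Lemma function_field_morphism
    (theta : {rmorphism {mpoly L[#|J|]} -> {mpoly L[#|I|]}}) :
  (forall P, evX (theta P) = 0 <-> evY P = 0) ->
  exists h : {rmorphism F -> E}, forall P, h (evY P) = evX (theta P).
Proof.
move=> theta0; have theta_neq0 Q : evY Q != 0 -> evX (theta Q) != 0.
  by move=> Q0; apply/eqP => /theta0/eqP; rewrite (negPf Q0).
have [N /choice[D ND]] := choice ffY.2.
pose h x := evX (theta (N x)) / evX (theta (D x)).
have hE x P Q : evY Q != 0 -> x = evY P / evY Q ->
    h x = evX (theta P) / evX (theta Q).
  move=> Q0 xPQ; have [D0 xND] := ND x.
  apply/eqP; rewrite eqr_div ?theta_neq0 // -subr_eq0 -!rmorphM -!rmorphB.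
  apply/eqP/theta0/eqP; rewrite rmorphB !rmorphM subr_eq0 -eqr_div //.
  by rewrite -xND xPQ.
have hP P : h (evY P) = evX (theta P).
  by rewrite (hE _ P 1) ?rmorph1 ?oner_eq0 ?divr1.
have hB : zmod_morphism h.
  move=> x y; have [[Dx xE] [Dy yE]] := (ND x, ND y).
  have [Tx Ty] := (theta_neq0 _ Dx, theta_neq0 _ Dy).
  rewrite (hE (x - y) (N x * D y - N y * D x) (D x * D y)).
  - by rewrite /h !rmorphB !rmorphM subf_div.
  - by rewrite rmorphM mulf_neq0.
  by rewrite {1}xE {1}yE rmorphB !rmorphM subf_div.
have hM : monoid_morphism h.
  split=> [|x y]; first by rewrite -(rmorph1 evY) hP !rmorph1.
  have [[Dx xE] [Dy yE]] := (ND x, ND y).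
  rewrite (hE (x * y) (N x * N y) (D x * D y)).
  - by rewrite /h !rmorphM mulf_div.
  - by rewrite rmorphM mulf_neq0.
  by rewrite {1}xE {1}yE !rmorphM mulf_div.
pose hz := GRing.isZmodMorphism.Build F E h hB.
pose hm := GRing.isMonoidMorphism.Build F E h hM.
pose H : {rmorphism F -> E} := HB.pack h hz hm.
by exists H.
Qed.

Variables (gamma : {ffun I -> L} -> {ffun J -> L}).
Variable Gamma : {ffun I -> L} -> {ffun J -> L} -> Prop.
Variables (j0 j1 : J) (A B : {mpoly L[#|I|]}).
Hypotheses (gammaP : forall j, polyfun (fun a => gamma a j))
  (gammaX : Y = gamma @` X) (GammaE : forall a, X a -> Gamma a (gamma a))
  (char2 : 2%N \in [pchar L])
  (gammaAB : forall a, X a -> gamma a j1 * peval B a ^+ 2 = gamma a j0 * peval A a ^+ 2)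
  (B0 : exists2 a, X a & peval B a != 0) (j0_neq0 : exists2 b, Y b & b j0 != 0)
  (nonsquare : forall P Q, (forall b, Y b -> peval P b ^+ 2 * b j0 = peval Q b ^+ 2 * b j1) ->
     forall b, Y b -> peval Q b = 0).

(** The quotient A/B on X has square gamma_j1 / gamma_j0, the pullback of a
    function that by assumption is not a square in the function field of Y. *)
Lemma not_separable_morphism : ~ separable_morphism X Y Gamma.
Proof.
have [f fE] := choice gammaP.
pose lq := [tuple f (enum_val i) | i < #|J|].
have lqE P a : peval (P \mPo lq) a = peval P (gamma a).
  rewrite /peval comp_mpoly_meval; apply: meval_eq => i.
  by rewrite tnth_mktuple -fE.
have [|h hE] := function_field_morphism (theta := comp_mpoly lq).
  move=> P; rewrite ffX.1 ffY.1; split=> P0 => [b|a Xa].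
    by rewrite gammaX => -[a Xa <-]; rewrite -lqE P0.
  by rewrite lqE P0 // gammaX; exists a.
have pullh : pullback Gamma evX evY h.
  move=> P Q1 Q2 PQ; rewrite hE -rmorphM; apply/eqP; rewrite -subr_eq0 -rmorphB.
  apply/eqP/ffX.1 => a Xa; rewrite /peval mevalB mevalM -!/(peval _ a) lqE.
  by rewrite (PQ a (gamma a)) ?subrr //; apply: GammaE.
move=> /(_ E F evX evY h ffX ffY pullh).
have Bx0 : evX B != 0.
  by apply/eqP => /ffX.1 BX; have [a /BX ->] := B0; rewrite eqxx.
have y0 : evY (pvar L j0) != 0.
  apply/eqP => /ffY.1 jY; have [b /jY] := j0_neq0.
  by rewrite peval_var => ->; rewrite eqxx.
apply: (@inseparable_square _ _ h (evY (pvar L j1) / evY (pvar L j0)) (evX A / evX B)).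
- have := rmorph_pchar (evX \o @mpolyC #|I| L) char2.
  by [].
- have v0 : evX (pvar L j0 \mPo lq) != 0 by rewrite -hE fmorph_eq0.
  rewrite fmorph_div !hE expr_div_n; apply/eqP; rewrite eqr_div ?expf_neq0 //.
  rewrite -!rmorphXn -!rmorphM -subr_eq0 -rmorphB; apply/eqP/ffX.1 => a Xa.
  rewrite /peval mevalB !mevalM -!/(peval _ a) !lqE !peval_var -!expr2.
  by rewrite gammaAB // mulrC subrr.
move=> d; have [P [Q [Q0 ->]]] := ffY.2 d.
rewrite expr_div_n => /eqP; rewrite eqr_div ?expf_neq0 //.
rewrite -!rmorphXn -!rmorphM -subr_eq0 -rmorphB => /eqP/ffY.1 PQ0.
move/eqP: Q0; apply; apply/ffY.1 => b; move: b; apply: (nonsquare (P := P)) => b Yb.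
have := PQ0 b Yb; rewrite /peval mevalB !mevalM -!/(peval _ b) !peval_var -!expr2.
by move/subr0_eq => ->; rewrite mulrC.
Qed.

End FunctionFieldMorphism.

(** * Power series: order, limits, units and cube roots *)

Section Order.
Variable K : fieldType.
Implicit Types f g h : pseries K.

(** Membership in the power m^n of the maximal ideal, in terms of
    coefficients (see [ideal_exp_maxP]). *)
Definition ord_ge n f := forall i j, (i + j < n)%N -> coef f i j = 0.

Lemma ps_coefD f g i j : coef (f + g) i j = coef f i j + coef g i j. Proof. by []. Qed.
Lemma ps_coefN f i j : coef (- f) i j = - coef f i j. Proof. by []. Qed.
Lemma ps_coefB f g i j : coef (f - g) i j = coef f i j - coef g i j. Proof. by []. Qed.
Lemma ps_coefZ c f i j : coef (c *: f) i j = c * coef f i j. Proof. by []. Qed.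
Lemma ps_coef1 i j : coef (1 : pseries K) i j = ((i == 0%N) && (j == 0%N))%:R.
Proof. by []. Qed.

Lemma ps_coef_sum (T : Type) (r : seq T) (P : pred T) (F : T -> pseries K) i j :
  coef (\sum_(k <- r | P k) F k) i j = \sum_(k <- r | P k) coef (F k) i j.
Proof. by apply: (big_morph (fun f : pseries K => coef f i j)). Qed.

Lemma coef_mono_mul a b f i j : coef (ps_mono K a b * f) i j =
  if (a <= i)%N && (b <= j)%N then coef f (i - a) (j - b) else 0.
Proof. exact: coef_monoM. Qed.

Lemma mono_mul a b c d : ps_mono K a b * ps_mono K c d = ps_mono K (a + c) (b + d).
Proof.
apply: pseriesP => i j; rewrite coef_mono_mul /=.
case: ifP => [/andP[ai bj]|]; first by rewrite -!(eqn_add2l a (i - a)) -!(eqn_add2l b (j - b)) !subnKC.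
move=> /negbT; rewrite negb_and -!ltnNge => /orP[] lt.
  by rewrite (ltn_eqF (leq_trans lt (leq_addr c a))).
by rewrite (ltn_eqF (leq_trans lt (leq_addr d b))) andbF.
Qed.

Lemma coef0M f g : coef (f * g) 0 0 = coef f 0 0 * coef g 0 0.
Proof.
have -> : coef (f * g) 0 0 = coef (ps_mul f g) 0 0 by [].
by rewrite /= !big_ord1 !subn0.
Qed.

Lemma ord_ge0 f : ord_ge 0 f. Proof. by []. Qed.

Lemma ord_ge_leq m n f : (m <= n)%N -> ord_ge n f -> ord_ge m f.
Proof. by move=> lemn f0 i j lt; apply: f0; apply: leq_trans lemn. Qed.

Lemma ord_geD n f g : ord_ge n f -> ord_ge n g -> ord_ge n (f + g).
Proof. by move=> f0 g0 i j lt; rewrite ps_coefD f0 // g0 // addr0. Qed.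

Lemma ord_geN n f : ord_ge n f -> ord_ge n (- f).
Proof. by move=> f0 i j lt; rewrite ps_coefN f0 // oppr0. Qed.

Lemma ord_geB n f g : ord_ge n f -> ord_ge n g -> ord_ge n (f - g).
Proof. by move=> f0 g0; apply/ord_geD/ord_geN. Qed.

Lemma ord_geZ n c f : ord_ge n f -> ord_ge n (c *: f).
Proof. by move=> f0 i j lt; rewrite ps_coefZ f0 // mulr0. Qed.

Lemma ord_ge_sum n (T : Type) (r : seq T) (P : pred T) (F : T -> pseries K) :
  (forall k, P k -> ord_ge n (F k)) -> ord_ge n (\sum_(k <- r | P k) F k).
Proof. by move=> F0; apply: big_ind => // f g; apply: ord_geD. Qed.

Lemma ord_geM m n f g : ord_ge m f -> ord_ge n g -> ord_ge (m + n) (f * g).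
Proof.
move=> f0 g0 i j ltij /=; rewrite big1 // => a _; rewrite big1 // => b _.
have [ltab|leab] := ltnP (a + b) m; first by rewrite f0 ?mul0r.
rewrite g0 ?mulr0 //; have := ltn_ord a; have := ltn_ord b; rewrite !ltnS.
move=> lebj leai; rewrite -(ltn_add2l m); apply: leq_ltn_trans ltij.
have -> : (i + j = (a + b) + ((i - a) + (j - b)))%N by rewrite addnACA !subnKC.
by rewrite leq_add2r.
Qed.

Lemma ord_geMr n f g : ord_ge n g -> ord_ge n (f * g).
Proof. exact: (@ord_geM 0). Qed.

Lemma ord_geMl n f g : ord_ge n f -> ord_ge n (f * g).
Proof. by rewrite mulrC; apply: ord_geMr. Qed.

Lemma ord_geX n f k : ord_ge n f -> ord_ge (k * n) (f ^+ k).
Proof.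
move=> f0; elim: k => [|k IHk]; first exact: ord_ge0.
by rewrite exprS mulSn; apply: ord_geM.
Qed.

Lemma ord_geX1 f k : ord_ge 1 f -> ord_ge k (f ^+ k).
Proof. by move=> f1; rewrite -[X in ord_ge X]muln1; apply: ord_geX. Qed.

Lemma ord_ge_eq0 f : (forall n, ord_ge n f) -> f = 0.
Proof. by move=> f0; apply: pseriesP => i j; apply: (f0 (i + j).+1). Qed.

Lemma ord_ge_X : ord_ge 1 (psX : pseries K). Proof. by case=> [|i] [|j]. Qed.
Lemma ord_ge_Y : ord_ge 1 (psY : pseries K). Proof. by case=> [|i] [|j]. Qed.

Lemma ord_ge1 f : coef f 0 0 = 0 -> ord_ge 1 f.
Proof. by move=> f0 [|i] [|j]. Qed.

Lemma ord_geSP n f : ord_ge n.+1 f ->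
  exists g h, [/\ ord_ge n g, ord_ge n h & f = psX * g + psY * h].
Proof.
move=> f0; exists (PSeries (fun i j => coef f i.+1 j)).
exists (PSeries (fun i j => if i is 0 then coef f 0 j.+1 else 0)); split.
- by move=> i j lt /=; rewrite f0.
- by move=> [|i] j lt //=; rewrite f0.
apply: pseriesP => i j; rewrite ps_coefD !coef_mono_mul.
case: i j => [|i] [|j]; rewrite /= ?subn1 ?subn0 /= ?addr0 ?add0r //.
exact: f0.
Qed.

Lemma ps_split f : exists g h, f = (coef f 0 0) *: 1 + psX * g + psY * h.
Proof.
have [|g [h [_ _ e]]] := @ord_geSP 0 (f - (coef f 0 0) *: 1).
  by apply: ord_ge1; rewrite ps_coefB ps_coefZ ps_coef1 mulr1 subrr.
by exists g, h; rewrite -addrA -e addrC subrK.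
Qed.

Lemma ps_linear_part f : ord_ge 2
  (f - ((coef f 0 0) *: 1 + (coef f 1 0) *: psX + (coef f 0 1) *: psY)).
Proof.
move=> i j; rewrite ps_coefB !ps_coefD !ps_coefZ ps_coef1 /=.
by case: i j => [|[|i]] [|[|j]] //= _; rewrite ?(mulr0, mulr1, addr0, add0r, subrr).
Qed.

(** Completeness of K[[x,y]] in the m-adic topology. *)
Lemma ps_limit (P : nat -> pseries K) :
  (forall n, ord_ge n.+1 (P n.+1 - P n)) ->
  exists p, forall n, ord_ge n.+1 (P n - p).
Proof.
move=> PS; exists (PSeries (fun i j => coef (P (i + j)%N) i j)) => n i j.
rewrite ltnS => len; rewrite ps_coefB /=; apply/eqP; rewrite subr_eq0; apply/eqP.
rewrite -(subnKC len); elim: (n - (i + j))%N => [|k IHk]; first by rewrite addn0.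
rewrite -[RHS]IHk addnS; apply: subr0_eq; rewrite -ps_coefB.
by apply: PS; rewrite ltnS leq_addr.
Qed.

Lemma unit_coef0 f g : f * g = 1 -> coef f 0 0 != 0.
Proof.
move=> /(congr1 (fun h => coef h 0 0)); rewrite coef0M ps_coef1 /= => e.
by apply: contra_eq_neq e => ->; rewrite mul0r eq_sym oner_eq0.
Qed.

(** Geometric series in 1 - f / f(0). *)
Lemma coef0_unit f : coef f 0 0 != 0 -> exists g, f * g = 1.
Proof.
move=> f0; pose c := coef f 0 0; pose n : pseries K := 1 - c^-1 *: f.
have n1 : ord_ge 1 n by apply: ord_ge1; rewrite ps_coefB ps_coefZ mulVf ?subrr.
have [|p pE] := @ps_limit (fun N => \sum_(k < N.+1) n ^+ k).
  move=> N; rewrite big_ord_recr /= addrAC subrr add0r.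
  exact: ord_geX1.
have p1 : (1 - n) * p = 1.
  apply/eqP; rewrite -subr_eq0; apply/eqP/ord_ge_eq0 => N.
  apply: (@ord_ge_leq N N.+1) => //.
  have -> : (1 - n) * p - 1 =
      - ((1 - n) * (\sum_(k < N.+1) n ^+ k - p)) - n ^+ N.+1.
    have := subrX1 n N.+1; rewrite -[n - 1]opprB mulNr => e.
    rewrite mulrBr -[(1 - n) * \sum__ _ _]opprK -e; ring.
  apply: ord_geB; first exact/ord_geN/ord_geMr.
  exact: ord_geX1.
exists (c^-1 *: p); rewrite -p1 /n opprB addrC subrK.
by rewrite -scalerAr scalerAl.
Qed.

Hypothesis char2 : 2%N \in [pchar K].

Lemma ps_addrr f : f + f = 0.
Proof. by apply: pseriesP => i j; rewrite ps_coefD addrr_pchar2. Qed.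

Lemma ps_sqrD f g : (f + g) ^+ 2 = f ^+ 2 + g ^+ 2.
Proof. by rewrite sqrrD mulr2n ps_addrr addr0. Qed.

(** Let w be the inverse of f.  The product p of the w^(4^k) converges since
    w^(4^k) = 1 + (w - 1)^(4^k), and it satisfies p = w p^4, so p^3 = f. *)
Lemma cube_root1 f : coef f 0 0 = 1 -> exists2 g, coef g 0 0 = 1 & g ^+ 3 = f.
Proof.
move=> f1; have [|w fw] := @coef0_unit f; first by rewrite f1 oner_eq0.
pose n := w - 1; have w1 : coef w 0 0 = 1.
  have := congr1 (fun h => coef h 0 0) fw.
  by rewrite coef0M f1 mul1r => ->; rewrite ps_coef1.
have n1 : ord_ge 1 n by apply: ord_ge1; rewrite ps_coefB w1 ps_coef1 subrr.
pose P N := \prod_(k < N) w ^+ (4 ^ k).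
have PS N : P N.+1 = w * P N ^+ 4.
  rewrite /P big_ord_recl expn0 expr1 -prodrXl; congr (_ * _).
  by apply: eq_bigr => k _; rewrite -exprM -expnSr.
have wX N : w ^+ (4 ^ N) = 1 + n ^+ (4 ^ N).
  elim: N => [|N IHN]; first by rewrite expn0 !expr1 addrC subrK.
  have sq (h : pseries K) : (1 + h) ^+ 4 = 1 + h ^+ 4.
    by rewrite (exprM _ 2 2) !ps_sqrD !expr1n -exprM.
  by rewrite expnSr exprM IHN sq -exprM.
have [|p pE] := @ps_limit P.
  move=> N; rewrite /P big_ord_recr /= -/(P N) wX mulrDr mulr1 addrAC subrr add0r.
  apply/ord_geMr/(@ord_ge_leq _ (4 ^ N)); last exact: ord_geX1.
  exact: ltn_expl.
have p1 : coef p 0 0 = 1.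
  have /eqP := pE 0%N 0%N 0%N (ltn0Sn _).
  by rewrite ps_coefB subr_eq0 /P big_ord0 ps_coef1 => /eqP.
have pw : p = w * p ^+ 4.
  apply/eqP; rewrite -subr_eq0; apply/eqP/ord_ge_eq0 => N.
  apply: (@ord_ge_leq N N.+1) => //.
  have -> : p - w * p ^+ 4 = w * (P N ^+ 4 - p ^+ 4) - (P N.+1 - p).
    by rewrite PS; ring.
  apply: ord_geB; last by apply: (@ord_ge_leq _ N.+2).
  by apply/ord_geMr; rewrite subrXX; apply: ord_geMl.
have [|v pv] := @coef0_unit p; first by rewrite p1 oner_eq0.
exists p => //; have wp3 : w * p ^+ 3 = 1.
  transitivity (w * p ^+ 4 * v); last by rewrite -pw.
  by rewrite -[LHS]mulr1 -pv; ring.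
by rewrite -[LHS]mul1r -fw -mulrA wp3 mulr1.
Qed.

Lemma cube_root f (c : K) : c != 0 -> coef f 0 0 = c ^+ 3 ->
  exists2 g, coef g 0 0 = c & g ^+ 3 = f.
Proof.
move=> c0 fc; have [|g g1 gE] := @cube_root1 ((c ^+ 3)^-1 *: f).
  by rewrite ps_coefZ fc mulVf // expf_neq0.
exists (c *: g); first by rewrite ps_coefZ g1 mulr1.
by rewrite exprZn gE scalerA divff ?scale1r // expf_neq0.
Qed.

End Order.

(** * Substitution and automorphisms *)

Section Substitution.
Variables (K : fieldType) (p q : pseries K).
Hypotheses (p1 : ord_ge 1 p) (q1 : ord_ge 1 q).
Implicit Types (f g : pseries K) (P Q : {poly {poly K}}).

Let trunc n f : {poly {poly K}} := \poly_(j < n) \poly_(i < n) coef f i j.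

Let coef_trunc n f i j :
  ((trunc n f)`_j)`_i = if (i < n)%N && (j < n)%N then coef f i j else 0.
Proof.
rewrite coef_poly; case: (j < n)%N; last by rewrite coef0 andbF.
by rewrite coef_poly andbT.
Qed.

Let ev P : pseries K := (map_poly (horner_alg p) P).[q].

Let evB P Q : ev (P - Q) = ev P - ev Q.
Proof. by rewrite /ev rmorphB hornerD hornerN. Qed.

Let evM P Q : ev (P * Q) = ev P * ev Q.
Proof. by rewrite /ev rmorphM hornerM. Qed.

(** Evaluation at (p, q) is continuous because p and q have no constant term. *)
Let ev_ord n P : (forall i j, (i + j < n)%N -> (P`_j)`_i = 0) -> ord_ge n (ev P).
Proof.
move=> P0; rewrite /ev horner_coef; apply: ord_ge_sum => j _.
have [in_j|le_j] := leqP n j; first by apply/ord_geMr/(ord_ge_leq in_j)/ord_geX1.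
rewrite coef_map /= /horner_alg /horner_morph horner_coef mulr_suml.
apply: ord_ge_sum => i _; rewrite coef_map /=.
have [lt|le] := ltnP (i + j) n; first by rewrite P0 // scale0r !mul0r.
rewrite -mulrA; apply/ord_geMr/(ord_ge_leq le)/ord_geM; exact: ord_geX1.
Qed.

Let sub f : pseries K := PSeries (fun i j => coef (ev (trunc (i + j).+1 f)) i j).

Let sub_ev n f : ord_ge n (sub f - ev (trunc n f)).
Proof.
move=> i j lt; rewrite ps_coefB /=; apply: subr0_eq; rewrite subr0 -ps_coefB -evB.
apply: (@ev_ord (i + j).+1) => // k l; rewrite ltnS => kl.
rewrite !coefB !coef_trunc !ltnS.
have [ki lj] := (leq_trans (leq_addr l k) kl, leq_trans (leq_addl k l) kl).
by rewrite ki lj (leq_ltn_trans ki lt) (leq_ltn_trans lj lt) subrr.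
Qed.

Let subB : zmod_morphism sub.
Proof.
move=> f g; apply/eqP; rewrite -subr_eq0; apply/eqP/ord_ge_eq0 => n.
have -> : sub (f - g) - (sub f - sub g) = (sub (f - g) - ev (trunc n (f - g))) -
    ((sub f - ev (trunc n f)) - (sub g - ev (trunc n g))) +
    ev (trunc n (f - g) - (trunc n f - trunc n g)).
  by rewrite !evB; ring.
apply: ord_geD; first by apply: ord_geB; last apply: ord_geB; apply: sub_ev.
apply: ev_ord => i j lt; rewrite !coefB !coef_trunc ps_coefB.
by case: ifP; rewrite ?subrr // subr0.
Qed.

Let subM : monoid_morphism sub.
Proof.
split=> [|f g]; apply/eqP; rewrite -subr_eq0; apply/eqP/ord_ge_eq0 => n.
  have -> : sub 1 - 1 = (sub 1 - ev (trunc n 1)) + (ev (trunc n 1) - ev 1).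
    by rewrite addrA subrK /ev rmorph1 hornerC.
  apply: ord_geD; first exact: sub_ev.
  rewrite -evB; apply: ev_ord => i j lt; rewrite !coefB coef_trunc ps_coef1 coef1.
  rewrite (leq_ltn_trans (leq_addr j i) lt) (leq_ltn_trans (leq_addl i j) lt) /=.
  case: j lt => [|j] lt; first by rewrite coef1 andbT subrr.
  by rewrite coef0 andbF subrr.
have -> : sub (f * g) - sub f * sub g =
    (sub (f * g) - ev (trunc n (f * g))) + ev (trunc n (f * g) - trunc n f * trunc n g)
    - (sub f - ev (trunc n f)) * sub g - ev (trunc n f) * (sub g - ev (trunc n g)).
  by rewrite evB evM; ring.
apply: ord_geB; last exact/ord_geMr/sub_ev.
apply: ord_geB; last exact/ord_geMl/sub_ev.
apply: ord_geD; first exact: sub_ev.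
apply: ev_ord => i j lt; rewrite !coefB coef_trunc.
have lti := leq_ltn_trans (leq_addr j i) lt.
have ltj := leq_ltn_trans (leq_addl i j) lt.
rewrite lti ltj /=; apply/eqP; rewrite subr_eq0 eq_sym; apply/eqP.
rewrite coefM coef_sum [RHS]exchange_big /=; apply: eq_bigr => b _.
rewrite coefM; apply: eq_bigr => a _; rewrite !coef_trunc.
have la : (a <= i)%N by rewrite -ltnS.
have lb : (b <= j)%N by rewrite -ltnS.
rewrite (leq_ltn_trans la lti) (leq_ltn_trans lb ltj).
by rewrite (leq_ltn_trans (leq_subr a i) lti) (leq_ltn_trans (leq_subr b j) ltj).
Qed.

Let subZ : scalable sub.
Proof.
move=> c f; apply/eqP; rewrite -subr_eq0; apply/eqP/ord_ge_eq0 => n.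
have evZ : ev (c%:P%:P * trunc n f) = c *: ev (trunc n f).
  by rewrite evM {1}/ev map_polyC /= hornerC horner_algC mulr_algl.
have -> : sub (c *: f) - c *: sub f = (sub (c *: f) - ev (trunc n (c *: f)))
    + ev (trunc n (c *: f) - c%:P%:P * trunc n f) - c *: (sub f - ev (trunc n f)).
  by rewrite evB evZ scalerBr; ring.
apply: ord_geB; last exact/ord_geZ/sub_ev.
apply: ord_geD; first exact: sub_ev.
apply: ev_ord => i j lt; rewrite !coefB !coefCM !coef_trunc ps_coefZ.
by case: ifP; rewrite ?subrr // mulr0 subr0.
Qed.

Let sub_gen (a b : nat) (r : pseries K) P :
  ev P = r -> (forall i j, (P`_j)`_i = coef (ps_mono K a b) i j) ->
  sub (ps_mono K a b) = r.
Proof.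
move=> <- PE; apply/eqP; rewrite -subr_eq0; apply/eqP/ord_ge_eq0 => n.
rewrite -(subrK (ev (trunc n (ps_mono K a b))) (sub _)) -addrA -evB.
apply: ord_geD; first exact: sub_ev.
apply: ev_ord => i j lt; rewrite !coefB coef_trunc PE.
by rewrite (leq_ltn_trans (leq_addr j i) lt) (leq_ltn_trans (leq_addl i j) lt) subrr.
Qed.

(** The value of the substitution at f is the limit of the values at the
    polynomial truncations of f. *)
Lemma substitution : exists phi : {lrmorphism pseries K -> pseries K},
  phi psX = p /\ phi psY = q.
Proof.
pose sz := GRing.isZmodMorphism.Build (pseries K) (pseries K) sub subB.
pose sm := GRing.isMonoidMorphism.Build (pseries K) (pseries K) sub subM.
pose sl := GRing.isScalable.Build K (pseries K) (pseries K) *:%R sub subZ.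
pose phi : {lrmorphism pseries K -> pseries K} := HB.pack sub sz sm sl.
exists phi; split.
  apply: (@sub_gen 1 0 _ 'X%:P).
    by rewrite /ev map_polyC /= hornerC horner_algX.
  move=> i [|j]; first by rewrite coefC /= coefX andbT.
  by rewrite coefC /= coef0 andbF.
apply: (@sub_gen 0 1 _ 'X).
  by rewrite /ev map_polyX hornerX.
move=> i j; rewrite coefX /=; case: (j == 1%N); first by rewrite coef1 andbT.
by rewrite coef0 andbF.
Qed.

End Substitution.

Section Endomorphisms.
Variable K : fieldType.
Implicit Types (f g : pseries K) (phi psi : {lrmorphism pseries K -> pseries K}).

(** Every K-algebra endomorphism is local: if phi f had constant term c, the
    unit f - c would be sent to a series without constant term. *)
Lemma endo_ord_ge1 phi f : ord_ge 1 f -> ord_ge 1 (phi f).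
Proof.
move=> f1; apply: ord_ge1; apply/eqP; apply: contraT => c0.
set c := coef (phi f) 0 0 in c0.
have [|v fv] := @coef0_unit _ (f - c *: 1).
  by rewrite ps_coefB ps_coefZ ps_coef1 mulr1 f1 // sub0r oppr_eq0.
have : phi (f - c *: 1) * phi v = 1 by rewrite -rmorphM fv rmorph1.
rewrite rmorphB /= linearZ /= rmorph1 => /unit_coef0.
by rewrite ps_coefB ps_coefZ ps_coef1 mulr1 subrr eqxx.
Qed.

Lemma endo_ord_ge phi n f : ord_ge n f -> ord_ge n (phi f).
Proof.
elim: n f => [|n IHn] f; first by move=> _; apply: ord_ge0.
move=> /ord_geSP[g [h [g0 h0 ->]]]; rewrite rmorphD !rmorphM /=.
apply: ord_geD; apply: (@ord_geM _ 1).
- exact/endo_ord_ge1/ord_ge_X.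
- exact: IHn.
- exact/endo_ord_ge1/ord_ge_Y.
- exact: IHn.
Qed.

(** By locality the values at f = c + x g + y h agree modulo m^(n+1) as soon
    as those at g and h agree modulo m^n. *)
Lemma endo_ext phi psi : phi psX = psi psX -> phi psY = psi psY -> phi =1 psi.
Proof.
move=> eX eY f; apply/eqP; rewrite -subr_eq0; apply/eqP/ord_ge_eq0 => n.
elim: n f => [|n IHn] f; first exact: ord_ge0.
have [g [h ->]] := ps_split f; set c := coef f 0 0.
have -> : phi (c *: 1 + psX * g + psY * h) - psi (c *: 1 + psX * g + psY * h) =
    phi psX * (phi g - psi g) + phi psY * (phi h - psi h).
  by rewrite !rmorphD !rmorphM /= !linearZ /= !rmorph1 eX eY; ring.
apply: ord_geD; apply: (@ord_geM _ 1) => //; apply: endo_ord_ge1.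
  exact: ord_ge_X.
exact: ord_ge_Y.
Qed.

Lemma endo_linear phi f i j : (i + j)%N = 1%N ->
  coef (phi f) i j =
  coef f 1 0 * coef (phi psX) i j + coef f 0 1 * coef (phi psY) i j.
Proof.
move=> ij1; have /(endo_ord_ge phi) := ps_linear_part f.
rewrite rmorphB !rmorphD /= !linearZ /= rmorph1 => /(_ i j).
rewrite ij1 ps_coefB !ps_coefD !ps_coefZ ps_coef1 => /(_ isT)/subr0_eq ->.
by case: i j ij1 => [|[|i]] [|[|j]] //= _; rewrite mulr0 add0r.
Qed.

Definition jacobian (p q : pseries K) :=
  coef p 1 0 * coef q 0 1 - coef p 0 1 * coef q 1 0.

(** The linear part of the inverse is inverse to the linear part of phi. *)
Lemma automorphism_jacobian phi : bijective phi ->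
  jacobian (phi psX) (phi psY) != 0.
Proof.
case=> psi _ psiK; rewrite /jacobian.
set a := coef (phi psX) 1 0; set b := coef (phi psX) 0 1.
set c := coef (phi psY) 1 0; set d := coef (phi psY) 0 1.
pose s f := coef (psi f) 1 0; pose t f := coef (psi f) 0 1.
have lin f i j : (i + j)%N = 1%N ->
    coef f i j = s f * coef (phi psX) i j + t f * coef (phi psY) i j.
  by move=> ij1; rewrite -endo_linear // psiK.
have eX0 : 1 = s psX * a + t psX * c := lin psX 1%N 0%N erefl.
have eX1 : 0 = s psX * b + t psX * d := lin psX 0%N 1%N erefl.
have eY0 : 0 = s psY * a + t psY * c := lin psY 1%N 0%N erefl.
have eY1 : 1 = s psY * b + t psY * d := lin psY 0%N 1%N erefl.
have : 1 = (s psX * t psY - t psX * s psY) * (a * d - b * c).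
  transitivity ((s psX * a + t psX * c) * (s psY * b + t psY * d) -
                (s psX * b + t psX * d) * (s psY * a + t psY * c)); last by ring.
  by rewrite -eX0 -eX1 -eY0 -eY1 mulr1 mulr0 subr0.
by move=> e; apply: contra_eq_neq e => ->; rewrite mulr0 oner_eq0.
Qed.

(** phi - id raises the order by at least one, so that phi is injective, and
    the iteration F |-> F + (g - phi F) converges to a preimage of g. *)
Lemma unipotent_bijective phi :
  ord_ge 2 (phi psX - psX) -> ord_ge 2 (phi psY - psY) -> bijective phi.
Proof.
move=> X2 Y2; have unip n f : ord_ge n f -> ord_ge n.+1 (phi f - f).
  elim: n f => [|n IHn] f.
    move=> _; have [g [h ->]] := ps_split f; set c := coef f 0 0.
    have -> : phi (c *: 1 + psX * g + psY * h) - (c *: 1 + psX * g + psY * h) =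
       phi (psX * g + psY * h) - (psX * g + psY * h).
      by rewrite -addrA rmorphD /= linearZ /= rmorph1; ring.
    suff m1 : ord_ge 1 (psX * g + psY * h) by apply: ord_geB => //; apply: endo_ord_ge.
    by apply: ord_geD; apply: ord_geMl; [exact: ord_ge_X|exact: ord_ge_Y].
  move=> /ord_geSP[g [h [g0 h0 ->]]].
  have -> : phi (psX * g + psY * h) - (psX * g + psY * h) =
      (phi psX - psX) * phi g + psX * (phi g - g) +
      ((phi psY - psY) * phi h + psY * (phi h - h)).
    by rewrite rmorphD !rmorphM; ring.
  have step (z w : pseries K) : ord_ge 1 z -> ord_ge 2 (phi z - z) -> ord_ge n w ->
      ord_ge n.+2 ((phi z - z) * phi w + z * (phi w - w)).
    move=> z1 z2 w0; apply: ord_geD.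
      by apply: (@ord_geM _ 2) => //; apply: endo_ord_ge.
    by apply: (@ord_geM _ 1) => //; apply: IHn.
  by apply: ord_geD; apply: step => //; [exact: ord_ge_X|exact: ord_ge_Y].
have inj f : phi f = 0 -> f = 0.
  move=> f0; apply: ord_ge_eq0 => n; elim: n => [|n /unip]; first exact: ord_ge0.
  by rewrite f0 sub0r => /ord_geN; rewrite opprK.
have surj g : exists f, phi f = g.
  pose F := fix F n := if n is n'.+1 then F n' + (g - phi (F n')) else 0.
  have Fg n : ord_ge n (g - phi (F n)).
    elim: n => [|n /unip/ord_geN]; first exact: ord_ge0.
    by rewrite opprB [phi (F n.+1)]rmorphD /= opprD addrA.
  have [|f fE] := @ps_limit _ (fun n => F n.+1).
    by move=> n; rewrite /= [_ + (g - _)]addrC addrK; apply: (Fg n.+1).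
  exists f; apply/esym/eqP; rewrite -subr_eq0; apply/eqP/ord_ge_eq0 => n.
  apply: (@ord_ge_leq _ n n.+1) => //.
  rewrite -(subrK (phi (F n.+1)) g) -addrA -rmorphB.
  by apply: ord_geD; [exact: Fg|apply/endo_ord_ge/fE].
have [psi psiK] := choice surj; exists psi => f //.
by apply/eqP; rewrite -subr_eq0; apply/eqP/inj; rewrite rmorphB /= psiK subrr.
Qed.

(** After composition with the inverse of its linear part, phi becomes
    unipotent. *)
Lemma jacobian_bijective phi : jacobian (phi psX) (phi psY) != 0 -> bijective phi.
Proof.
set p := phi psX; set q := phi psY; set J := jacobian p q => J0.
pose a := coef p 1 0; pose b := coef p 0 1; pose c := coef q 1 0; pose d := coef q 0 1.
have ordL s t : ord_ge 1 (s *: psX + t *: psY : pseries K).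
  by apply: ord_geD; apply: ord_geZ; [exact: ord_ge_X|exact: ord_ge_Y].
(* lam is the inverse of the linear part of phi, and mu is that linear part. *)
have [lam [lamX lamY]] := substitution (ordL (d / J) (- b / J)) (ordL (- c / J) (a / J)).
have [mu [muX muY]] := substitution (ordL a b) (ordL c d).
have JE : (a * d - b * c) / J = 1 by rewrite -(divff J0).
have lamK f : lam (mu f) = f.
  apply: (@endo_ext (lam \o mu) idfun) => /=.
    rewrite muX rmorphD /= !linearZ /= lamX lamY !scalerDr !scalerA addrACA -!scalerDl.
    have -> : a * (d / J) + b * (- c / J) = 1 by rewrite -JE; field.
    have -> : a * (- b / J) + b * (a / J) = 0 by field.
    by rewrite scale1r scale0r addr0.
  rewrite muY rmorphD /= !linearZ /= lamX lamY !scalerDr !scalerA addrACA -!scalerDl.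
  have -> : c * (d / J) + d * (- c / J) = 0 by field.
  have -> : c * (- b / J) + d * (a / J) = 1 by rewrite -JE; field.
  by rewrite scale1r scale0r add0r.
have linP (s t : K) : ord_ge 2 (phi (s *: psX + t *: psY) -
    ((s * a + t * c) *: psX + (s * b + t * d) *: psY)).
  have ord1 f : ord_ge 1 f -> ord_ge 2 (f - (coef f 1 0 *: psX + coef f 0 1 *: psY)).
    by move=> f1; have := ps_linear_part f; rewrite f1 // scale0r add0r.
  have -> : phi (s *: psX + t *: psY) - ((s * a + t * c) *: psX + (s * b + t * d) *: psY) =
      s *: (p - (a *: psX + b *: psY)) + t *: (q - (c *: psX + d *: psY)).
    rewrite rmorphD /= !linearZ /= -/p -/q !scalerBr !scalerDr !scalerA !scalerDl; ring.
  apply: ord_geD; apply: ord_geZ; apply: ord1; apply: endo_ord_ge1.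
    exact: ord_ge_X.
  exact: ord_ge_Y.
have [] := @unipotent_bijective (phi \o lam) => /=.
- rewrite lamX; have := linP (d / J) (- b / J).
  have -> : d / J * a + - b / J * c = 1 by rewrite -JE; field.
  have -> : d / J * b + - b / J * d = 0 by field.
  by rewrite scale1r scale0r addr0.
- rewrite lamY; have := linP (- c / J) (a / J).
  have -> : - c / J * a + a / J * c = 0 by field.
  have -> : - c / J * b + a / J * d = 1 by rewrite -JE; field.
  by rewrite scale1r scale0r add0r.
move=> psi psiK phiK; exists (lam \o psi) => f /=; last exact: phiK.
by rewrite -{1}(lamK f) psiK lamK.
Qed.

Lemma contact_with_images (u p q : pseries K) :
  coef u 0 0 != 0 -> coef p 0 0 = 0 -> coef q 0 0 = 0 -> jacobian p q != 0 ->
  exists g : contact K, [/\ cunit g = u, caut g psX = p & caut g psY = q].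
Proof.
move=> u0 p0 q0 J0; have [phi [phiX phiY]] := substitution (ord_ge1 p0) (ord_ge1 q0).
have bij : bijective phi by apply: jacobian_bijective; rewrite phiX phiY.
by exists (Contact (coef0_unit u0) bij).
Qed.

Lemma contact_local (g : contact K) :
  [/\ coef (cunit g) 0 0 != 0, ord_ge 1 (caut g psX), ord_ge 1 (caut g psY) &
      jacobian (caut g psX) (caut g psY) != 0].
Proof.
split.
- by have [v /unit_coef0] := cunitP g.
- exact/endo_ord_ge1/ord_ge_X.
- exact/endo_ord_ge1/ord_ge_Y.
- exact/automorphism_jacobian/cautP.
Qed.

End Endomorphisms.

(** * Tangent image and determinacy of the cusp *)

Section IdealGenerated.
Variables (R : comNzRingType) (S : set R).

Lemma ideal_gen_ind (P : R -> Prop) : P 0 -> (forall a b, P a -> P b -> P (a + b)) ->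
  (forall c s, S s -> P (c * s)) -> forall a, ideal_gen S a -> P a.
Proof. by move=> P0 PD PM a [n [c [s [Ss ->]]]]; apply: big_ind => // i _; apply: PM. Qed.

Lemma ideal_genM c s : S s -> ideal_gen S (c * s).
Proof. by move=> Ss; exists 1%N, (fun=> c), (fun=> s); rewrite big_ord1. Qed.

Lemma ideal_gen0 : ideal_gen S 0.
Proof. by exists 0%N, (fun=> 0), (fun=> 0); split=> [[]//|]; rewrite big_ord0. Qed.

Lemma ideal_genD a b : ideal_gen S a -> ideal_gen S b -> ideal_gen S (a + b).
Proof.
move=> [n [c [s [Ss ->]]]] [m [d [t [St ->]]]].
exists (n + m)%N.
exists (fun i => match split i with inl j => c j | inr j => d j end).
exists (fun i => match split i with inl j => s j | inr j => t j end).
split=> [i|]; first by case: (split i).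
rewrite big_split_ord /=; congr (_ + _); apply: eq_bigr => i _.
  by rewrite -[lshift m i]/(unsplit (inl _ i)) unsplitK.
by rewrite -[rshift n i]/(unsplit (inr _ i)) unsplitK.
Qed.

End IdealGenerated.

Definition coefs_vanish (K : fieldType) (s : seq (nat * nat)) : set (pseries K) :=
  [set f | forall p, p \in s -> coef f p.1 p.2 = 0].

(** The monomials with exponents in s represent a basis of the quotient. *)
Lemma coefs_vanish_codim (K : fieldType) (s : seq (nat * nat)) : uniq s ->
  has_codim (@coefs_vanish K s) (size s).
Proof.
move=> us; pose pos (i : 'I_(size s)) := nth (0, 0)%N s i.
have posP (p : nat * nat) : p \in s -> exists i, p = pos i.
  by move=> sp; exists (Ordinal (etrans (index_mem p s) sp)); rewrite /pos /= nth_index.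
exists (fun i => ps_mono K (pos i).1 (pos i).2) => v.
have coef_pos (c : {ffun 'I_(size s) -> K}) i :
    coef (v - \sum_(j < size s) c j *: ps_mono K (pos j).1 (pos j).2) (pos i).1 (pos i).2 =
    coef v (pos i).1 (pos i).2 - c i.
  rewrite ps_coefB ps_coef_sum (bigD1 i) //= !eqxx mulr1 big1 ?addr0 // => j ji.
  case: andP; last by rewrite mulr0.
  move=> [/eqP e1 /eqP e2]; case/eqP: ji; apply: val_inj => /=.
  apply/eqP; rewrite -(nth_uniq (0, 0)%N (ltn_ord j) (ltn_ord i) us) -!/(pos _).
  by rewrite [pos j]surjective_pairing [pos i]surjective_pairing e1 e2.
exists [ffun i => coef v (pos i).1 (pos i).2]; split=> [p /posP[i ->]|c cW].
  by rewrite coef_pos ffunE subrr.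
apply/ffunP => i; rewrite ffunE; apply: subr0_eq; rewrite -coef_pos; apply: cW.
exact: mem_nth.
Qed.

Section Cusp.
Variable K : fieldType.
Hypothesis char2 : 2%N \in [pchar K].

Definition cusp : pseries K := psX ^+ 2 + psY ^+ 3.

Lemma monoX2 : psX ^+ 2 = ps_mono K 2%N 0%N.
Proof. by rewrite expr2 mono_mul. Qed.
Lemma monoY2 : psY ^+ 2 = ps_mono K 0%N 2%N.
Proof. by rewrite expr2 mono_mul. Qed.
Lemma monoY3 : psY ^+ 3 = ps_mono K 0%N 3%N.
Proof. by rewrite exprS monoY2 mono_mul. Qed.
Lemma monoXY2 : psX * psY ^+ 2 = ps_mono K 1%N 2%N.
Proof. by rewrite monoY2 mono_mul. Qed.

Lemma coef_cusp i j : coef cusp i j =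
  ((i == 2%N) && (j == 0%N))%:R + ((i == 0%N) && (j == 3%N))%:R.
Proof. by rewrite /cusp monoX2 monoY3. Qed.

(** The substitution y |-> y (V/U)^(1/3) followed by multiplication by U. *)
Lemma cusp_form_orbit (U V : pseries K) (c : K) :
  c != 0 -> coef U 0 0 != 0 -> coef V 0 0 = coef U 0 0 * c ^+ 3 ->
  corbit cusp (U * psX ^+ 2 + V * psY ^+ 3).
Proof.
move=> c0 U0 Vc; have [U' UU'] := coef0_unit U0.
have [|v v0 v3] := @cube_root _ char2 (U' * V) c c0.
  rewrite coef0M Vc mulrA; have := congr1 (fun h => coef h 0 0) UU'.
  by rewrite coef0M mulrC => ->; rewrite mul1r.
have Yv i j : coef (psY * v) i j = if (0 < j)%N then coef v i j.-1 else 0.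
  by rewrite coef_mono_mul /= subn0 subn1.
have [||||g [gu gX gY]] := @contact_with_images _ U psX (psY * v).
- by [].
- by [].
- by rewrite Yv.
- by rewrite /jacobian !Yv /= v0 mul1r mul0r subr0.
exists g => //; rewrite /cact gu /cusp rmorphD !rmorphXn /= gX gY.
rewrite exprMn v3 mulrDr; congr (_ + _).
by rewrite -[RHS]mul1r -UU'; ring.
Qed.

(** Every monomial of degree at least 5 is divisible by x^2 or by y^3, which
    gives h = U x^2 + V y^3. *)
Lemma cusp_determined : determined 4 cusp.
Proof.
move=> h /ideal_exp_maxP hf.
have hE i j : (i + j < 5)%N -> coef h i j = coef cusp i j.
  by move=> lt; apply: subr0_eq; rewrite -ps_coefB hf.
pose U := PSeries (fun i j => coef h i.+2 j).
pose V := PSeries (fun i j => if (i < 2)%N then coef h i j.+3 else 0).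
have -> : h = U * psX ^+ 2 + V * psY ^+ 3.
  apply: pseriesP => i j; rewrite monoX2 monoY3 ![_ * ps_mono _ _ _]mulrC.
  rewrite ps_coefD !coef_mono_mul.
  case: i => [|[|i]]; last by rewrite /= !subSS !subn0 /= if_same addr0.
    case: j => [|[|[|j]]]; rewrite /= ?add0r ?subSS ?subn0 /= // hE // coef_cusp addr0 //.
  case: j => [|[|[|j]]]; rewrite /= ?add0r ?subSS ?subn0 /= // hE // coef_cusp addr0 //.
by apply: (@cusp_form_orbit _ _ 1); rewrite ?oner_eq0 //= !hE // !coef_cusp /= ?addr0 ?add0r
  ?expr1n ?mulr1 ?oner_eq0.
Qed.

Definition tangent_image_seq : seq (nat * nat) :=
  [:: (0, 0); (1, 0); (0, 1); (1, 1); (0, 2)]%N.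

(** Every monomial outside the list is divisible by x^2, xy^2 or y^3. *)
Lemma tangent_image_seqP (f : pseries K) : coefs_vanish tangent_image_seq f ->
  exists u v w, f = u * psX ^+ 2 + v * (psX * psY ^+ 2) + w * psY ^+ 3.
Proof.
rewrite monoX2 monoXY2 monoY3 => f0.
exists (PSeries (fun i j => coef f i.+2 j)).
exists (PSeries (fun i j => if i is 0 then coef f 1 j.+2 else 0)).
exists (PSeries (fun i j => if i is 0 then coef f 0 j.+3 else 0)).
apply: pseriesP => i j; rewrite ![_ * ps_mono _ _ _]mulrC.
rewrite !ps_coefD !coef_mono_mul.
case: i => [|[|i]].
- case: j => [|[|[|j]]]; rewrite /= ?add0r ?subSS ?subn0 //.
  + exact: (f0 (0, 0)%N).
  + exact: (f0 (0, 1)%N).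
  + exact: (f0 (0, 2)%N).
- case: j => [|[|j]]; rewrite /= ?add0r ?subSS ?subn0 ?addr0 //.
  + exact: (f0 (1, 0)%N).
  + exact: (f0 (1, 1)%N).
  by case: ifP => _; rewrite addr0.
by rewrite /= !subSS !subn0 /= !if_same !addr0.
Qed.

Lemma tangent_monomials : ideal_gen [set psX ^+ 2; psX * psY ^+ 2; psY ^+ 3] =
  @coefs_vanish K tangent_image_seq.
Proof.
rewrite monoX2 monoXY2 monoY3; apply/seteqP; split=> f.
  move: f; apply: ideal_gen_ind.
  - by move=> p _.
  - by move=> f g f0 g0 p sp; rewrite ps_coefD f0 // g0 // addr0.
  move=> c s Ss p; rewrite mulrC !inE.
  case: Ss => [[->|->]|->]; rewrite coef_mono_mul.
  - by move=> /or4P[||| /orP[]] /eqP ->.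
  - by move=> /or4P[||| /orP[]] /eqP ->.
  - by move=> /or4P[||| /orP[]] /eqP ->.
rewrite -monoX2 -monoXY2 -monoY3 => /tangent_image_seqP[u [v [w ->]]].
by apply: ideal_genD; first apply: ideal_genD; apply: ideal_genM; [left; left|left; right|right].
Qed.

Lemma cusp_dx : ps_dx cusp = 0.
Proof.
apply: pseriesP => i j; transitivity (coef cusp i.+1 j *+ i.+1) => //.
rewrite coef_cusp /= addr0; case: andP => [[/eqP -> _]|_]; last exact: mul0rn.
by rewrite mulr2n addrr_pchar2.
Qed.

Lemma cusp_dy : ps_dy cusp = psY ^+ 2.
Proof.
apply: pseriesP => i j; transitivity (coef cusp i j.+1 *+ j.+1) => //.
rewrite coef_cusp monoY2 /= andbF add0r eqSS.
case: andP => [[_ /eqP ->]|_]; last exact: mul0rn.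
by rewrite (mulrS _ 2) mulr2n addrr_pchar2 // addr0.
Qed.

Lemma cusp_tangent_image : tangent_image cusp =
  ideal_gen [set psX ^+ 2; psX * psY ^+ 2; psY ^+ 3].
Proof.
rewrite /tangent_image cusp_dx cusp_dy; set I := RHS.
have I0 : I 0 by apply: ideal_gen0.
have ID := @ideal_genD _ [set psX ^+ 2; psX * psY ^+ 2; psY ^+ 3 : pseries K].
have IM c (s : pseries K) : s \in [:: psX ^+ 2; psX * psY ^+ 2; psY ^+ 3] -> I (c * s).
  rewrite !inE => /or3P[] /eqP ->; apply: ideal_genM; by [left; left|left; right|right].
apply/seteqP; split=> [f [b [c [+ + ->]]]|f].
  move=> fb mc; apply: (ID); move: fb mc.
    move=> + _; move: b; apply: ideal_gen_ind => [//|b b'|b s ->]; first exact: ID.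
    by rewrite mulrDr; apply: (ID); apply: IM; rewrite !inE eqxx ?orbT.
  move=> _; move: c; apply: ideal_gen_ind => [//|c c'|a _ [m [d [mm + ->]]]].
    exact: ID.
  move: d; apply: ideal_gen_ind => [|d d' Id Id'|d s ss].
  - by rewrite !mulr0.
  - by rewrite !mulrDr; exact: ID.
  move: m mm; apply: ideal_gen_ind => [|m m' Im Im'|m t tt].
  - by rewrite mul0r mulr0.
  - by rewrite mulrDl mulrDr; exact: ID.
  case: ss => ->; first by rewrite !mulr0.
  case: tt => ->.
    have -> : a * (m * psX * (d * psY ^+ 2)) = a * m * d * (psX * psY ^+ 2) by ring.
    by apply: IM; rewrite !inE eqxx orbT.
  have -> : a * (m * psY * (d * psY ^+ 2)) = a * m * d * psY ^+ 3 by ring.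
  by apply: IM; rewrite !inE eqxx !orbT.
rewrite /I tangent_monomials => /tangent_image_seqP[u [v [w ->]]].
exists (u * cusp), (1 * ((v * psX + (w - u) * psY) * (1 * psY ^+ 2))); split.
- exact: ideal_genM.
- apply: ideal_genM; exists (v * psX + (w - u) * psY), (1 * psY ^+ 2); split=> //.
    by apply: ideal_genD; apply: ideal_genM; [left|right].
  by apply: ideal_genM; right.
by rewrite /cusp; ring.
Qed.

Lemma cusp_predeterminacy : predeterminacy_bound cusp 2.
Proof.
rewrite /predeterminacy_bound cusp_tangent_image tangent_monomials; split=> [f|q qI].
  move=> /ideal_exp_maxP f0 p; rewrite !inE.
  by move=> /or4P[||| /orP[]] /eqP ->; apply: f0.
rewrite leqNgt; apply/negP => q2.
have : coefs_vanish tangent_image_seq (psY ^+ 2 : pseries K).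
  apply: qI; apply/ideal_exp_maxP => i j lt; rewrite monoY2 /=.
  case: andP => // -[/eqP i0 /eqP j2]; move: lt; rewrite i0 j2 add0n.
  by move=> /leq_trans/(_ q2).
move=> /(_ (0, 2)%N); rewrite !inE monoY2 /= => /(_ isT)/eqP.
by rewrite oner_eq0.
Qed.

Lemma ideal_exp_max_codim3 : has_codim (ideal_exp (@maxideal K) 3) 6.
Proof.
pose s := [:: (0, 0); (1, 0); (0, 1); (2, 0); (1, 1); (0, 2)]%N.
have -> : ideal_exp (@maxideal K) 3 = coefs_vanish s.
  apply/seteqP; split=> f; rewrite ideal_exp_maxP => f0.
    move=> p sp; apply: f0.
    by move: sp; rewrite !inE => /or4P[||| /or3P[]] /eqP ->.
  case=> [|[|[|i]]] [|[|[|j]]] // _.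
  - exact: (f0 (0, 0)%N).
  - exact: (f0 (0, 1)%N).
  - exact: (f0 (0, 2)%N).
  - exact: (f0 (1, 0)%N).
  - exact: (f0 (1, 1)%N).
  - exact: (f0 (2, 0)%N).
exact: (@coefs_vanish_codim K s).
Qed.

End Cusp.

(** * Graph charts and coordinates on jets *)

Section GraphChart.
Variables (L : closedFieldType) (I : finType) (s : seq I).

Local Notation free_index := {i : I | i \notin s}.

Lemma card_free_index : uniq s -> #|{: free_index}| = (#|I| - size s)%N.
Proof.
move=> us; rewrite card_sig -(cardC (mem s)) (card_uniqP us) addKn.
by apply: eq_card.
Qed.

Definition cut (a : {ffun I -> L}) : {ffun I -> L} := [ffun i => if i \in s then 0 else a i].
Definition extend (t : {ffun free_index -> L}) : {ffun I -> L} :=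
  [ffun i => if insub i is Some k then t k else 0].
Definition restrict (a : {ffun I -> L}) : {ffun free_index -> L} := [ffun k => a (val k)].

Lemma extend_restrict a : extend (restrict a) = cut a.
Proof.
apply/ffunP => i; rewrite !ffunE; case: insubP => [k ki vk|].
  by rewrite ffunE vk (negPf ki).
by rewrite negbK => ->.
Qed.

Lemma extend_free t (k : free_index) : extend t (val k) = t k.
Proof. by rewrite ffunE valK. Qed.

Lemma extend_polyfun i : polyfun (fun t => extend t i).
Proof.
case E : (insub i : option free_index) => [k|].
  by apply: polyfun_ext (polyfun_coord L k) => t; rewrite ffunE E.
by apply: polyfun_ext (polyfunC _ 0) => t; rewrite ffunE E.
Qed.

Variables (X Q : set {ffun I -> L}) (r : {ffun I -> L} -> I -> L).
Variables (D E : {ffun I -> L} -> L) (p : {ffun I -> L}).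
Hypotheses (XE : X = [set a | Q (cut a) /\ forall i, i \in s -> a i = r (cut a) i])
  (DP : polyfun D) (D0 : forall a, Q a -> D a != 0)
  (rD : forall i, exists2 q, polyfun q & forall a, Q a -> r a i * D a = q a)
  (EP : polyfun E) (E0 : E (cut p) != 0) (EQ : forall a, E a != 0 -> Q a).

Definition graph_map (t : {ffun free_index -> L}) : {ffun I -> L} :=
  [ffun i => if i \in s then r (extend t) i else extend t i].

Lemma restrict_graph t : restrict (graph_map t) = t.
Proof. by apply/ffunP => k; rewrite !ffunE (negPf (valP k)) valK. Qed.

(** A set on which the coordinates indexed by s are rational functions r of
    the others is parametrized by those other coordinates. *)
Lemma graph_chart : rational_chart X [set t | Q (extend t)] graph_map restrict
  (fun t => D (extend t)) (fun t => E (extend t)) (restrict p).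
Proof.
have extP := extend_polyfun; split.
- rewrite XE; apply/seteqP; split=> [a [Qa ra]|_ [t Qt <-]] /=.
    exists (restrict a); first by rewrite /= extend_restrict.
    apply/ffunP => i; rewrite ffunE extend_restrict; case: ifP => [/ra //|si].
    by rewrite ffunE si.
  rewrite -extend_restrict restrict_graph; split=> // i si.
  by rewrite ffunE si.
- by move=> k; apply: polyfun_ext (polyfun_coord L (val k)) => a; rewrite ffunE.
- by move=> t _; apply: restrict_graph.
- exact: polyfun_comp DP.
- by move=> t /D0.
- move=> i; have [si|si] := boolP (i \in s).
    have [q qP qE] := rD i; exists (fun t => q (extend t)); first exact: polyfun_comp qP.
    by move=> t Qt; rewrite ffunE si qE.
  exists (fun t => extend t i * D (extend t)); last by move=> t _; rewrite ffunE (negPf si).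
  by apply: polyfunM; [exact: extP|exact: polyfun_comp DP].
- exact: polyfun_comp EP.
- by rewrite extend_restrict.
- by move=> t /EQ.
Qed.

End GraphChart.

Section JetIndex.
Variables (F : fieldType) (k : nat).
Implicit Types f : pseries F.

Definition jet_index0 : jet_index k := exist _ (ord0, ord0) (leq0n k).
Definition jix i j : jet_index k := insubd jet_index0 (inord i, inord j).

Lemma jixE i j : (i + j <= k)%N -> val (jix i j) = (inord i, inord j).
Proof.
move=> ijk; rewrite insubdK // /in_mem /= !inordK // ltnS.
  exact: leq_trans (leq_addl _ _) ijk.
exact: leq_trans (leq_addr _ _) ijk.
Qed.

Lemma jix1 i j : (i + j <= k)%N -> (val (jix i j)).1 = i :> nat.
Proof.
by move=> ijk; rewrite jixE // inordK // ltnS (leq_trans (leq_addr _ _) ijk).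
Qed.

Lemma jix2 i j : (i + j <= k)%N -> (val (jix i j)).2 = j :> nat.
Proof.
by move=> ijk; rewrite jixE // inordK // ltnS (leq_trans (leq_addl _ _) ijk).
Qed.

Lemma jet_jix f i j : (i + j <= k)%N -> jet k f (jix i j) = coef f i j.
Proof. by move=> ijk; rewrite ffunE jix1 ?jix2. Qed.

Lemma jix_eq i j p : (i + j <= k)%N ->
  (p == jix i j) = ((val p).1 == i :> nat) && ((val p).2 == j :> nat).
Proof.
move=> ijk; apply/eqP/andP => [->|[/eqP e1 /eqP e2]]; first by rewrite jix1 ?jix2.
apply: val_inj; rewrite [LHS]surjective_pairing [RHS]surjective_pairing.
by congr (_, _); apply: val_inj => /=; rewrite ?e1 ?e2 ?jix1 ?jix2.
Qed.

Lemma jix_neq i j i' j' : (i + j <= k)%N -> (i' + j' <= k)%N ->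
  (jix i j == jix i' j') = (i == i') && (j == j').
Proof. by move=> h h'; rewrite jix_eq // jix1 ?jix2. Qed.

End JetIndex.

Lemma card_jet_index2 : #|{: jet_index 2}| = 6%N.
Proof.
rewrite card_sig -sum1_card.
rewrite (eq_bigl (fun p : 'I_3 * 'I_3 => (p.1 + p.2 <= 2)%N)) //.
rewrite -(pair_big_dep xpredT (fun i j : 'I_3 => (i + j <= 2)%N) (fun _ _ => 1%N)) /=.
rewrite (eq_bigr (fun i : 'I_3 => \sum_(j < 3) nat_of_bool (i + j <= 2)%N)).
  by rewrite !big_ord_recl !big_ord0.
by move=> i _; rewrite big_mkcond; apply: eq_bigr => j _; case: (_ <= _)%N.
Qed.

(** * The 2-jets of the contact group and of the orbit *)

Local Notation CI := (contact_index 2).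
(* Coordinates of a 2-jet (u, phi): the coefficients of x^i y^j in u, phi(x)
   and phi(y). *)
Local Notation u_ i j := (inl (jix 2 i j) : CI).
Local Notation x_ i j := (inr (inl (jix 2 i j)) : CI).
Local Notation y_ i j := (inr (inr (jix 2 i j)) : CI).

Section ContactJets.
Variable L : closedFieldType.
Hypothesis char2 : 2%N \in [pchar L].

Implicit Types (a : {ffun CI -> L}) (b : {ffun jet_index 2 -> L}).

Definition jet_jacobian a := a (x_ 1 0) * a (y_ 0 1) - a (x_ 0 1) * a (y_ 1 0).

Lemma contact_jetE (g : contact L) (i j : nat) : (i + j <= 2)%N ->
  [/\ contact_jet 2 g (u_ i j) = coef (cunit g) i j,
      contact_jet 2 g (x_ i j) = coef (caut g psX) i j &
      contact_jet 2 g (y_ i j) = coef (caut g psY) i j].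
Proof. by move=> ij; split; rewrite ffunE jet_jix. Qed.

Lemma jet_groupE : jet_group L 2 =
  [set a : {ffun CI -> L} | [/\ a (x_ 0 0) = 0, a (y_ 0 0) = 0 & a (u_ 0 0) * jet_jacobian a != 0]].
Proof.
have [e00 e10 e01] : [/\ (0 + 0 <= 2), (1 + 0 <= 2) & (0 + 1 <= 2)]%N by [].
apply/seteqP; split=> [_ [g _ <-]|a [ax ay aj]] /=.
  have [u0 p0 q0 J0] := contact_local g.
  have [eu ex ey] := contact_jetE g e00.
  split; [by rewrite ex p0|by rewrite ey q0|].
  have [_ ex1 ey1] := contact_jetE g e10; have [_ ex2 ey2] := contact_jetE g e01.
  by rewrite /jet_jacobian eu ex1 ex2 ey1 ey2 mulf_neq0.
have [u uE] := jet_surj [ffun p => a (inl p)].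
have [p pE] := jet_surj [ffun p => a (inr (inl p))].
have [q qE] := jet_surj [ffun p => a (inr (inr p))].
have uE' i j : (i + j <= 2)%N -> coef u i j = a (u_ i j).
  by move=> ij; rewrite -(jet_jix _ ij) uE ffunE.
have pE' i j : (i + j <= 2)%N -> coef p i j = a (x_ i j).
  by move=> ij; rewrite -(jet_jix _ ij) pE ffunE.
have qE' i j : (i + j <= 2)%N -> coef q i j = a (y_ i j).
  by move=> ij; rewrite -(jet_jix _ ij) qE ffunE.
move: aj; rewrite mulf_eq0 negb_or => /andP[au aj].
have [||||g [gu gx gy]] := @contact_with_images _ u p q.
- by rewrite uE'.
- by rewrite pE'.
- by rewrite qE'.
- by rewrite /jacobian !pE' ?qE'.
exists g => //; apply/ffunP => -[i|[i|i]]; rewrite ffunE ?gu ?gx ?gy.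
- by rewrite uE ffunE.
- by rewrite pE ffunE.
- by rewrite qE ffunE.
Qed.

(** The linear part ax + by of phi(x) is the only contribution to the 2-jet of
    phi(x)^2, since squaring is additive, and phi(y)^3 has order 3. *)
Lemma coef_cact (g : contact L) i j : (i + j <= 2)%N ->
  coef (cact g (cusp L)) i j =
  coef (cunit g) 0 0 * coef (caut g psX) 1 0 ^+ 2 * ((i == 2%N) && (j == 0%N))%:R +
  coef (cunit g) 0 0 * coef (caut g psX) 0 1 ^+ 2 * ((i == 0%N) && (j == 2%N))%:R.
Proof.
have [_ X1 Y1 _] := contact_local g.
have -> : cact g (cusp L) = cunit g * (caut g psX ^+ 2 + caut g psY ^+ 3).
  by rewrite /cact /cusp rmorphD !rmorphXn.
set u := cunit g; set p := caut g psX; set q := caut g psY.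
set c := coef u 0 0; set s := coef p 1 0; set t := coef p 0 1 => ij.
have p2 := ps_linear_part p; rewrite X1 // scale0r add0r in p2.
set r := p - _ in p2.
have pE : p = r + (s *: psX + t *: psY) by rewrite subrK.
have u1 : ord_ge 1 (u - c *: 1).
  by apply: ord_ge1; rewrite ps_coefB ps_coefZ ps_coef1 mulr1 subrr.
pose m := (c * s ^+ 2) *: ps_mono L 2%N 0%N + (c * t ^+ 2) *: ps_mono L 0%N 2%N.
have mE : m = (c *: 1) * (s *: psX + t *: psY) ^+ 2.
  rewrite ps_sqrD // !exprZn monoX2 monoY2 mulr_algl scalerDr !scalerA.
  by [].
have -> : u * (p ^+ 2 + q ^+ 3) = m +
    (u * r ^+ 2 + u * q ^+ 3 + (u - c *: 1) * (s *: psX + t *: psY) ^+ 2).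
  by rewrite mE pE ps_sqrD //; ring.
rewrite ps_coefD [X in _ + X](_ : _ = 0) ?addr0 //.
have : ord_ge 3 (u * r ^+ 2 + u * q ^+ 3 + (u - c *: 1) * (s *: psX + t *: psY) ^+ 2).
  apply: ord_geD; first apply: ord_geD.
  - apply/ord_geMr/(@ord_ge_leq _ _ (2 * 2)%N) => //; exact: ord_geX.
  - apply/ord_geMr; exact: ord_geX1.
  apply: (@ord_geM _ 1) => //; apply: ord_geX1.
  by apply: ord_geD; apply: ord_geZ; [exact: ord_ge_X|exact: ord_ge_Y].
by apply.
Qed.

Definition orbit_coord a : {ffun jet_index 2 -> L} := [ffun p =>
  if p == jix 2 2 0 then a (u_ 0 0) * a (x_ 1 0) ^+ 2 else
  if p == jix 2 0 2 then a (u_ 0 0) * a (x_ 0 1) ^+ 2 else 0].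

Lemma jet_cact (g : contact L) : jet 2 (cact g (cusp L)) = orbit_coord (contact_jet 2 g).
Proof.
apply/ffunP => p; rewrite ffunE coef_cact; last exact: (valP p).
rewrite !ffunE !jix_eq // !jix1 // !jix2 //.
case: andP => [[/eqP -> /eqP ->]|_]; first by rewrite /= mulr1 mulr0 addr0.
by case: andP => _; rewrite ?mulr0 ?mulr1 ?add0r ?addr0.
Qed.

Lemma orbit_coordE a : [/\ orbit_coord a (jix 2 2 0) = a (u_ 0 0) * a (x_ 1 0) ^+ 2,
  orbit_coord a (jix 2 0 2) = a (u_ 0 0) * a (x_ 0 1) ^+ 2 &
  forall p, p != jix 2 2 0 -> p != jix 2 0 2 -> orbit_coord a p = 0].
Proof.
split; first by rewrite ffunE eqxx.
  by rewrite ffunE jix_neq //= eqxx.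
by move=> p /negPf p1 /negPf p2; rewrite ffunE p1 p2.
Qed.

Lemma orbit_mapE a b : orbit_map 2 (cusp L) a b <-> jet_group L 2 a /\ b = orbit_coord a.
Proof.
split=> [[g [-> ->]]|[[g _ <-] ->]]; first by rewrite jet_cact; split=> //; exists g.
by exists g; rewrite jet_cact.
Qed.

Lemma jet_orbit_image : jet_orbit 2 (cusp L) = orbit_coord @` jet_group L 2.
Proof.
apply/seteqP; split=> [_ [g _ <-]|_ [_ [g _ <-] <-]].
  by exists (contact_jet 2 g); rewrite ?jet_cact //; exists g.
by exists g; rewrite ?jet_cact.
Qed.

Lemma closed_sqrt (c : L) : exists d, d ^+ 2 = c.
Proof.
have : size ('X^2 - c%:P) != 1%N by rewrite size_XnsubC.
move/closed_rootP => [d]; rewrite /root !hornerE subr_eq0 => /eqP e.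
by exists d.
Qed.

Lemma closed_cbrt (c : L) : exists d, d ^+ 3 = c.
Proof.
have : size ('X^3 - c%:P) != 1%N by rewrite size_XnsubC.
move/closed_rootP => [d]; rewrite /root !hornerE subr_eq0 => /eqP e.
by exists d.
Qed.

(** Every scalar is a square in the algebraically closed field L, so each nonzero
    alpha x^2 + beta y^2 occurs. *)
Lemma jet_orbitE : jet_orbit 2 (cusp L) =
  [set b : {ffun jet_index 2 -> L} | (b (jix 2 2 0) != 0 \/ b (jix 2 0 2) != 0) /\
           forall p, p != jix 2 2 0 -> p != jix 2 0 2 -> b p = 0].
Proof.
apply/seteqP; split=> [_ [g _ <-]|b [b0 bz]].
  rewrite jet_cact; have [e1 e2 e3] := orbit_coordE (contact_jet 2 g).
  rewrite /= e1 e2; split; last exact: e3.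
  have : jet_group L 2 (contact_jet 2 g) by exists g.
  rewrite jet_groupE => -[_ _]; set a := contact_jet 2 g.
  rewrite mulf_eq0 negb_or => /andP[au aj].
  have [x0|x0] := eqVneq (a (x_ 1 0)) 0; last by left; rewrite mulf_neq0 ?expf_neq0.
  right; rewrite mulf_neq0 ?expf_neq0 //; apply: contraNneq aj => x1.
  by rewrite /jet_jacobian x0 x1 !mul0r subrr.
have [s sE] := closed_sqrt (b (jix 2 2 0)); have [t tE] := closed_sqrt (b (jix 2 0 2)).
(* phi(y) only serves to make the linear part of phi invertible. *)
pose q : pseries L := if s == 0 then psX else psY.
have [||||g [gu gx _]] := @contact_with_images L 1 (s *: psX + t *: psY) q.
- by rewrite ps_coef1 oner_eq0.
- by rewrite ps_coefD !ps_coefZ /= !mulr0 addr0.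
- by rewrite /q; case: ifP.
- rewrite /jacobian !ps_coefD !ps_coefZ /= !mulr0 !mulr1 addr0 add0r /q.
  case: (eqVneq s 0) => [s0|s0] /=; last by rewrite mulr1 mulr0 subr0.
  rewrite mulr0 mulr1 sub0r oppr_eq0; case: b0 => [|].
    by rewrite -sE s0 expr0n eqxx.
  by apply: contraNneq => t0; rewrite -tE t0 expr0n.
exists g => //; apply/ffunP => p; rewrite ffunE coef_cact; last exact: (valP p).
rewrite gu gx ps_coef1 !mul1r !ps_coefD !ps_coefZ /= !mulr0 !mulr1 addr0 add0r sE tE.
rewrite -!(@jix_eq 2) //.
have [->|p1] := eqVneq p (jix 2 2 0); first by rewrite jix_neq //= mulr1 mulr0 addr0.
have [->|p2] := eqVneq p (jix 2 0 2); first by rewrite mulr1 mulr0 add0r.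
by rewrite !mulr0 addr0 bz.
Qed.

End ContactJets.

Section Dimensions.
Variable L : closedFieldType.
Hypothesis char2 : 2%N \in [pchar L].

Lemma card_contact_index2 : #|{: CI}| = 18%N.
Proof. by rewrite !card_sum card_jet_index2. Qed.

Lemma contact_index_eq (i j i' j' : nat) : (i + j <= 2)%N -> (i' + j' <= 2)%N ->
  [/\ (u_ i j == u_ i' j') = ((i == i') && (j == j')),
      (x_ i j == x_ i' j') = ((i == i') && (j == j')) &
      (y_ i j == y_ i' j') = ((i == i') && (j == j'))].
Proof. by move=> h h'; split; rewrite [LHS]/eq_op /= -(jix_neq h h'). Qed.

Let cmp : [/\ (x_ 1 0 == x_ 0 0) = false, (x_ 0 1 == x_ 0 0) = false,
  (y_ 1 0 == y_ 0 0) = false, (y_ 0 1 == y_ 0 0) = false &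
  (x_ 1 0 == x_ 0 1) = false].
Proof.
split; first by have [_ -> _] := @contact_index_eq 1 0 0 0 isT isT.
- by have [_ -> _] := @contact_index_eq 0 1 0 0 isT isT.
- by have [_ _ ->] := @contact_index_eq 1 0 0 0 isT isT.
- by have [_ _ ->] := @contact_index_eq 0 1 0 0 isT isT.
by have [_ -> _] := @contact_index_eq 1 0 0 1 isT isT.
Qed.

Definition group_seq : seq CI := [:: x_ 0 0; y_ 0 0].

Definition identity_jet : {ffun CI -> L} := [ffun i =>
  if i \in [:: u_ 0 0; x_ 1 0; y_ 0 1] then 1 else 0].

Let cut_group (a : {ffun CI -> L}) :
  [/\ cut group_seq a (u_ 0 0) = a (u_ 0 0), cut group_seq a (x_ 1 0) = a (x_ 1 0),
      cut group_seq a (x_ 0 1) = a (x_ 0 1), cut group_seq a (y_ 1 0) = a (y_ 1 0) &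
      cut group_seq a (y_ 0 1) = a (y_ 0 1)].
Proof.
by have [e1 e2 e3 e4 e5] := cmp; split; rewrite ffunE !inE ?e1 ?e2 ?e3 ?e4.
Qed.

Let identity_jetE : [/\ identity_jet (u_ 0 0) = 1, identity_jet (x_ 1 0) = 1,
  identity_jet (x_ 0 1) = 0 & identity_jet (y_ 0 1) = 1].
Proof.
have [e1 e2 e3 e4 e5] := cmp; split; rewrite ffunE !inE ?eqxx ?orbT //.
by rewrite [x_ 0 1 == x_ 1 0]eq_sym e5.
Qed.

Lemma jet_jacobian_polyfun : polyfun (@jet_jacobian L).
Proof. by apply: polyfunB; apply: polyfunM; apply: polyfun_coord. Qed.

Lemma jet_group_chart : exists U psi D E p,
  rational_chart (jet_group L 2) U (@graph_map L CI group_seq (fun _ _ => 0)) psi D E p.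
Proof.
pose E (a : {ffun CI -> L}) := a (u_ 0 0) * jet_jacobian a.
do 5!eexists; apply: (graph_chart (p := identity_jet)
  (Q := [set a | E a != 0]) (D := fun=> 1) (E := E)).
- rewrite jet_groupE; apply/seteqP; split=> a;
    rewrite /E /= /jet_jacobian; have [-> -> -> -> ->] := cut_group a.
    by move=> [ax ay aj]; split=> // i; rewrite !inE => /orP[] /eqP ->.
  by move=> [aj a0]; split=> //; apply: a0; rewrite !inE eqxx ?orbT.
- exact: polyfunC.
- by move=> a _; apply: oner_neq0.
- by move=> i; exists (fun=> 0); [apply: polyfunC|move=> a _; rewrite mul0r].
- by apply: polyfunM; [apply: polyfun_coord|apply: jet_jacobian_polyfun].
- rewrite /E /jet_jacobian; have [-> -> -> -> ->] := cut_group identity_jet.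
  have [-> -> -> ->] := identity_jetE.
  by rewrite !mul1r mul0r subr0 oner_eq0.
- by [].
Qed.

Lemma jet_group_dim : has_dim (jet_group L 2) 16.
Proof.
have [U [psi [D [E [p ch]]]]] := jet_group_chart.
by have := chart_dim ch; rewrite card_free_index ?card_contact_index2.
Qed.

Definition stabilizer_seq : seq CI := [:: x_ 0 0; y_ 0 0; x_ 0 1; u_ 0 0].

Let cut_stab (a : {ffun CI -> L}) :
  [/\ cut stabilizer_seq a (x_ 1 0) = a (x_ 1 0), cut stabilizer_seq a (y_ 1 0) = a (y_ 1 0) &
      cut stabilizer_seq a (y_ 0 1) = a (y_ 0 1)].
Proof.
by have [e1 e2 e3 e4 e5] := cmp; split; rewrite ffunE !inE ?e1 ?e2 ?e3 ?e4 ?e5.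
Qed.

Lemma jet_stabilizerE : jet_stabilizer 2 (cusp L) =
  [set a : {ffun CI -> L} | [/\ a (x_ 0 0) = 0, a (y_ 0 0) = 0, a (x_ 0 1) = 0,
     a (u_ 0 0) * a (x_ 1 0) ^+ 2 = 1 & a (y_ 0 1) != 0]].
Proof.
have cuspJ p : jet 2 (cusp L) p = if p == jix 2 2 0 then 1 else 0.
  rewrite ffunE coef_cusp jix_eq // [X in _ + X](_ : _ = 0) ?addr0.
    by case: ifP.
  case: andP => // -[/eqP p1 /eqP p2].
  by have := valP p; rewrite p1 p2.
have stabE (a : {ffun CI -> L}) : jet_stabilizer 2 (cusp L) a <->
    jet_group L 2 a /\ orbit_coord a = jet 2 (cusp L).
  split=> [[g [-> e]]|[[g _ <-] e]]; first by rewrite -jet_cact // e; split=> //; exists g.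
  by exists g; rewrite jet_cact.
apply/seteqP; split=> a; rewrite stabE jet_groupE /=.
  move=> [[ax ay +] e]; have [e1 e2 e3] := orbit_coordE a.
  rewrite e !cuspJ eqxx in e1; rewrite e !cuspJ jix_neq //= in e2.
  rewrite mulf_eq0 negb_or => /andP[au aj].
  have x01 : a (x_ 0 1) = 0.
    by move/esym/eqP: e2; rewrite mulf_eq0 (negPf au) expf_eq0 /= => /eqP.
  split=> //; apply: contraNneq aj => y01.
  by rewrite /jet_jacobian y01 x01 mulr0 mul0r subrr.
move=> [ax ay x01 ux y01]; have ux0 : a (u_ 0 0) * a (x_ 1 0) ^+ 2 != 0 by rewrite ux oner_eq0.
move: ux0; rewrite mulf_eq0 expf_eq0 negb_or => /andP[u0 x0]; split.
  by split=> //; rewrite /jet_jacobian x01 mul0r subr0 !mulf_neq0.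
apply/ffunP => p; rewrite cuspJ ffunE ux x01 expr0n mulr0.
by case: ifP => // _; rewrite if_same.
Qed.

Lemma jet_stabilizer_dim : has_dim (jet_stabilizer 2 (cusp L)) 14.
Proof.
pose E (a : {ffun CI -> L}) := a (x_ 1 0) * a (y_ 0 1).
pose r (a : {ffun CI -> L}) (i : CI) := if i == u_ 0 0 then (a (x_ 1 0) ^+ 2)^-1 else 0.
have [e1 e2 e3 e4 e5] := cmp.
have ch : rational_chart (jet_stabilizer 2 (cusp L)) [set t | [set a | E a != 0] (extend t)]
    (@graph_map L CI stabilizer_seq r) (@restrict L CI stabilizer_seq)
    (fun t => extend t (x_ 1 0) ^+ 2) (fun t => E (extend t)) (restrict _ identity_jet).
  apply: (graph_chart (D := fun a => a (x_ 1 0) ^+ 2)).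
  - rewrite jet_stabilizerE; apply/seteqP; split=> a; rewrite /E /= /r;
      have [-> _ ->] := cut_stab a.
      move=> [ax ay x01 ux y01].
      have : a (u_ 0 0) * a (x_ 1 0) ^+ 2 != 0 by rewrite ux oner_eq0.
      rewrite mulf_eq0 expf_eq0 negb_or => /andP[u0 x0]; split; first exact: mulf_neq0.
      move=> i; rewrite !inE => /or4P[] /eqP -> //=.
      by rewrite eqxx; apply: (mulIf (expf_neq0 2 x0)); rewrite ux mulVf ?expf_neq0.
    rewrite mulf_eq0 negb_or => -[/andP[x0 y0] ar]; split=> //.
    + by rewrite ar ?inE ?eqxx.
    + by rewrite ar ?inE ?eqxx ?orbT.
    + by rewrite ar ?inE ?eqxx ?orbT.
    + by rewrite ar ?inE ?eqxx ?orbT // mulVf ?expf_neq0.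
  - by apply/polyfunX/polyfun_coord.
  - by move=> a; rewrite /E /= mulf_eq0 negb_or => /andP[x0 _]; rewrite expf_neq0.
  - move=> i; exists (fun=> if i == u_ 0 0 then 1 else 0); first exact: polyfunC.
    move=> a; rewrite /E /= mulf_eq0 negb_or => /andP[x0 _]; rewrite /r.
    by case: ifP; rewrite ?mul0r // mulVf // expf_neq0.
  - by apply: polyfunM; apply: polyfun_coord.
  - rewrite /E; have [-> _ ->] := cut_stab identity_jet; have [_ -> _ ->] := identity_jetE.
    by rewrite mul1r oner_eq0.
  - by [].
have := chart_dim ch; rewrite card_free_index ?card_contact_index2 //.
by rewrite /= !inE [x_ 0 0 == x_ 0 1]eq_sym e2.
Qed.

Definition orbit_seq : seq (jet_index 2) := [:: jix 2 0 0; jix 2 1 0; jix 2 0 1; jix 2 1 1].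

Lemma orbit_seqE p : (p \in orbit_seq) = (p != jix 2 2 0) && (p != jix 2 0 2).
Proof.
rewrite !inE !jix_eq //; case: p => [[[[|[|[|i]]] hi] [[|[|[|j]]] hj]] /= hp] //.
Qed.

Lemma jet_orbit_chart : exists U psi D E p,
  rational_chart (jet_orbit 2 (cusp L)) U (@graph_map L _ orbit_seq (fun _ _ => 0)) psi D E p.
Proof.
have n20 : jix 2 2 0 \notin orbit_seq by rewrite orbit_seqE eqxx.
have n02 : jix 2 0 2 \notin orbit_seq by rewrite orbit_seqE eqxx andbF.
pose Q : set {ffun jet_index 2 -> L} := [set b | b (jix 2 2 0) != 0 \/ b (jix 2 0 2) != 0].
do 5!eexists; apply: (graph_chart (p := [ffun=> 1 : L]) (Q := Q) (D := fun=> 1)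
   (E := fun b => b (jix 2 2 0))).
- rewrite jet_orbitE // /Q; apply/seteqP; split=> b /=;
    rewrite !ffunE (negPf n20) (negPf n02) => -[b0 bz]; split=> // p.
    by rewrite orbit_seqE => /andP[]; apply: bz.
  by move=> p1 p2; apply: bz; rewrite orbit_seqE p1.
- exact: polyfunC.
- by move=> a _; apply: oner_neq0.
- by move=> i; exists (fun=> 0); [apply: polyfunC|move=> a _; rewrite mul0r].
- exact: polyfun_coord.
- by rewrite !ffunE (negPf n20) oner_eq0.
- by left.
Qed.

Lemma jet_orbit_dim : has_dim (jet_orbit 2 (cusp L)) 2.
Proof.
have [U [psi [D [E [p ch]]]]] := jet_orbit_chart.
have := chart_dim ch; rewrite card_free_index ?card_jet_index2 //.
by rewrite /= !inE !jix_neq.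
Qed.

Lemma affine_space_dim (I : finType) : has_dim [set: {ffun I -> L}] #|I|.
Proof.
have ch : rational_chart [set: {ffun I -> L}] setT id id (fun=> 1) (fun=> 1) 0.
  split=> //.
  - by apply/seteqP; split=> // a _; exists a.
  - by move=> j; apply: polyfun_coord.
  - exact: polyfunC.
  - by move=> *; apply: oner_neq0.
  - by move=> i; exists (fun t => t i); [apply: polyfun_coord|move=> *; rewrite mulr1].
  - exact: polyfunC.
  - exact: oner_neq0.
exact: chart_dim ch.
Qed.

Lemma jet_orbit_codim : has_codim_in [set: {ffun jet_index 2 -> L}] (jet_orbit 2 (cusp L)) 4.
Proof.
exists 6%N, 2%N; split=> //; last exact: jet_orbit_dim.
by have := affine_space_dim (jet_index 2); rewrite card_jet_index2.
Qed.

(** The exponents of 'X_i in the leading monomials of the two sides have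
    different parity. *)
Lemma square_mul_var n (P Q : {mpoly L[n]}) (i j : 'I_n) :
  i != j -> P ^+ 2 * 'X_i = Q ^+ 2 * 'X_j -> Q = 0.
Proof.
move=> ij PQ; apply/eqP; apply: contraT => Q0.
have X0 (k : 'I_n) : ('X_k : {mpoly L[n]}) != 0.
  by rewrite -mleadc_eq0 mleadXm mcoeffX eqxx oner_eq0.
have P0 : P != 0.
  apply: contraNneq (Q0) => P0; move/eqP: PQ; rewrite P0 expr0n mul0r eq_sym.
  by rewrite mulf_eq0 (negPf (X0 j)) orbF expf_eq0.
have := congr1 (fun T => mlead T i) PQ.
rewrite /= !mleadM ?expf_neq0 // !mleadXm !mnmDE !mnm1E !addnn.
rewrite eqxx [j == i]eq_sym (negPf ij) => /(congr1 odd).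
by rewrite !oddD !odd_double.
Qed.

(** The function b/a on the group is a square root of beta/alpha. *)
Lemma orbit_map_inseparable :
  ~ separable_morphism (jet_group L 2) (jet_orbit 2 (cusp L)) (orbit_map 2 (cusp L)).
Proof.
have [U [psi [D [E [p ch]]]]] := jet_group_chart.
have [U' [psi' [D' [E' [p' ch']]]]] := jet_orbit_chart.
have phiP (I : finType) (s : seq I) i :
    polyfun (fun t => @graph_map L I s (fun _ _ => 0) t i).
  have [si|si] := boolP (i \in s).
    by apply: polyfun_ext (polyfunC _ 0) => t; rewrite [RHS]ffunE si.
  by apply: polyfun_ext (extend_polyfun L s i) => t; rewrite [RHS]ffunE (negPf si).
have [evX ffX] := chart_function_field ch (@phiP _ _).
have [evY ffY] := chart_function_field ch' (@phiP _ _).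
have oE := @orbit_coordE L.
apply: (not_separable_morphism ffX ffY (gamma := @orbit_coord L)
  (j0 := jix 2 2 0) (j1 := jix 2 0 2) (A := pvar L (x_ 0 1)) (B := pvar L (x_ 1 0))) => //.
- move=> j; have [->|j20] := eqVneq j (jix 2 2 0).
    apply: (@polyfun_ext _ _ (fun a => a (u_ 0 0) * a (x_ 1 0) ^+ 2)).
      by move=> a; have [->] := oE a.
    by apply: polyfunM; [|apply: polyfunX]; apply: polyfun_coord.
  have [->|j02] := eqVneq j (jix 2 0 2).
    apply: (@polyfun_ext _ _ (fun a => a (u_ 0 0) * a (x_ 0 1) ^+ 2)).
      by move=> a; have [_ ->] := oE a.
    by apply: polyfunM; [|apply: polyfunX]; apply: polyfun_coord.
  by apply: polyfun_ext (polyfunC _ 0) => a; have [_ _ ->] := oE a.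
- exact: jet_orbit_image.
- by move=> a Xa; apply/orbit_mapE.
- move=> a _; have [-> -> _] := oE a; rewrite !peval_var; ring.
- exists identity_jet; last by rewrite peval_var; have [_ -> _ _] := identity_jetE; rewrite oner_eq0.
  rewrite jet_groupE /=; have [e1 e2 e3 e4 e5] := cmp; have [i1 i2 i3 i4] := identity_jetE.
  split.
  + by rewrite ffunE !inE [x_ 0 0 == x_ 1 0]eq_sym e1.
  + by rewrite ffunE !inE [y_ 0 0 == y_ 0 1]eq_sym e4.
  by rewrite /jet_jacobian i1 i2 i3 i4 !mul1r mul0r subr0 oner_eq0.
- exists [ffun p => if p == jix 2 2 0 then 1 else 0]; last by rewrite ffunE eqxx oner_eq0.
  rewrite jet_orbitE //=; split; first by left; rewrite ffunE eqxx oner_eq0.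
  by move=> q q1 _; rewrite ffunE (negPf q1).
move=> P Q PQ b; rewrite (chart_image ch') => -[t Ut <-].
have n20 : jix 2 2 0 \notin orbit_seq by rewrite orbit_seqE eqxx.
have n02 : jix 2 0 2 \notin orbit_seq by rewrite orbit_seqE eqxx andbF.
pose k0 : {i | i \notin orbit_seq} := exist (fun i => i \notin orbit_seq) _ n20.
pose k1 : {i | i \notin orbit_seq} := exist (fun i => i \notin orbit_seq) _ n02.
have [P' P'E] := polyfun_comp (@phiP _ orbit_seq) (polyfun_peval P).
have [Q' Q'E] := polyfun_comp (@phiP _ orbit_seq) (polyfun_peval Q).
have Q0 : Q' = 0.
  apply: (@square_mul_var _ P' Q' (enum_rank k0) (enum_rank k1)).
    by rewrite (inj_eq enum_rank_inj) -val_eqE /= jix_neq.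
  apply: mpoly_polyfun_ext => v; apply: subr0_eq; move: v.
  apply: (chart_dense ch').
    by apply: polyfunB; apply: polyfun_peval.
  move=> v Uv; have Yv : jet_orbit 2 (cusp L) (@graph_map L _ orbit_seq (fun _ _ => 0) v).
    by rewrite (chart_image ch'); exists v.
  have gE (k : {i | i \notin orbit_seq}) :
      @graph_map L _ orbit_seq (fun _ _ => 0) v (val k) = v k.
    by rewrite [LHS]ffunE (negPf (valP k)) extend_free.
  have := PQ _ Yv; rewrite -P'E -Q'E (gE k0) (gE k1) => e.
  rewrite -!/(pvar L _) /peval !mevalM -!/(peval _ v) !peval_var -!expr2.
  by rewrite e subrr.
by rewrite -Q'E Q0 /peval meval0.
Qed.

End Dimensions.

(** * The tangent space *)

Section TangentSpace.
Variable L : closedFieldType.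
Hypothesis char2 : 2%N \in [pchar L].

Lemma tangent_coord (I : finType) (X : set {ffun I -> L}) a v j :
  tangent_at X a v -> (forall b, X b -> b j = 0) -> v j = 0.
Proof.
move=> /(_ (pvar L j)) tv Xj; rewrite -[RHS]tv; last by move=> b Xb; rewrite peval_var Xj.
rewrite (bigD1 (enum_rank j)) //= enum_rankK big1 ?addr0 => [|i ij]; rewrite mderivX mnm1E.
  have -> : (U_(enum_rank j) - U_(enum_rank j) = 0 :> 'X_{1..#|I|})%MM.
    by apply/mnmP => i; rewrite !mnmE subnn.
  by rewrite eqxx scale1r mpolyX0 /peval meval1 mul1r.
by rewrite eq_sym (negPf ij) scale0r /peval meval0 mul0r.
Qed.

(** The curves needed below are at most cubic in their parameter. *)
Lemma tangent_at_jets k (X : set {ffun jet_index k -> L}) (r : {poly L})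
    (f0 f1 f2 f3 : pseries L) : r != 0 ->
  (forall z, r.[z] != 0 -> X (jet k (f0 + z *: f1 + z ^+ 2 *: f2 + z ^+ 3 *: f3))) ->
  tangent_at X (jet k f0) (jet k f1).
Proof.
move=> r0 Xz.
pose c (p : jet_index k) : {poly L} := let C f := (coef f (val p).1 (val p).2)%:P in
  C f0 + C f1 * 'X + C f2 * 'X^2 + C f3 * 'X^3.
have cE z : curve_pt c z = jet k (f0 + z *: f1 + z ^+ 2 *: f2 + z ^+ 3 *: f3).
  apply/ffunP => p; rewrite !ffunE !ps_coefD !ps_coefZ /c.
  by rewrite !(hornerD, hornerM, hornerC, hornerX, hornerXn); ring.
have -> : jet k f0 = curve_pt c 0.
  by rewrite cE !expr0n !scale0r !addr0.
have -> : jet k f1 = [ffun p => (c p)^`().[0]].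
  apply/ffunP => p; rewrite !ffunE /c !derivD !derivM !derivC !derivX.
  rewrite !(hornerD, hornerM, hornerMn, hornerC, hornerX, hornerXn, horner0) /=.
  by rewrite !(mul0r, mulr0, addr0, add0r, expr0n, mul0rn) ?mulr1.
by apply: (tangent_at_curve r0) => z /Xz; rewrite cE.
Qed.

Lemma cusp_orbit_images (p q : pseries L) : coef p 0 0 = 0 -> coef q 0 0 = 0 ->
  jacobian p q != 0 -> corbit (cusp L) (p ^+ 2 + q ^+ 3).
Proof.
move=> p0 q0 J0; have [|g [gu gp gq]] := @contact_with_images L 1 p q _ p0 q0 J0.
  by rewrite ps_coef1 oner_eq0.
by exists g => //; rewrite /cact gu mul1r /cusp rmorphD !rmorphXn /= gp gq.
Qed.

Lemma jet_orbit_corbit k f : corbit (cusp L) f -> jet_orbit k (cusp L) (jet k f).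
Proof. by move=> [g _ <-]; exists g. Qed.

(** The binomial coefficients 3 are 1 in characteristic 2. *)
Let mulXY (h : pseries L) : (psY + h * psX) ^+ 3 =
  psY ^+ 3 + h * (psX * psY ^+ 2) + h ^+ 2 * (psX ^+ 2 * psY) + h ^+ 3 * psX ^+ 3.
Proof.
transitivity (psY ^+ 3 + h * (psX * psY ^+ 2) + h ^+ 2 * (psX ^+ 2 * psY) + h ^+ 3 * psX ^+ 3
  + (h * (psX * psY ^+ 2) + h * (psX * psY ^+ 2))
  + (h ^+ 2 * (psX ^+ 2 * psY) + h ^+ 2 * (psX ^+ 2 * psY))); first by ring.
by rewrite !(ps_addrr char2) !addr0.
Qed.

(** The summands are tangent, in this order of proof, to the curves
    (1 + zu) x^2 + (1 + zw) y^3, x^2 + (y + zvx)^3 and f + z y^2, where the last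
    one is (x + sy)^2 + y^3 with s^2 = z. *)
Lemma cusp_tangent_sub k (u v w : pseries L) (e : L) :
  tangent_at (jet_orbit k (cusp L)) (jet k (cusp L))
    (jet k (u * psX ^+ 2 + v * (psX * psY ^+ 2) + w * psY ^+ 3 + e *: psY ^+ 2)).
Proof.
pose u0 := coef u 0 0; pose w0 := coef w 0 0.
have t1 : tangent_at (jet_orbit k (cusp L)) (jet k (cusp L))
    (jet k (u * psX ^+ 2 + w * psY ^+ 3)).
  (* The excluded values of z are those for which 1 + zu or 1 + zw is not a unit. *)
  apply: (@tangent_at_jets k _ ((1 + u0 *: 'X) * (1 + w0 *: 'X)) _ _ 0 0).
    apply/eqP => /(congr1 (fun P => P.[0])); rewrite !(hornerM, hornerD, hornerZ, hornerC, hornerX).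
    by rewrite ?(mulr0, addr0, mulr1) => /eqP; rewrite oner_eq0.
  move=> z; rewrite !(hornerM, hornerD, hornerZ, hornerC, hornerX) mulf_eq0 negb_or => /andP[uz wz].
  apply: jet_orbit_corbit; rewrite !scaler0 !addr0.
  have -> : cusp L + z *: (u * psX ^+ 2 + w * psY ^+ 3) =
      (1 + z *: u) * psX ^+ 2 + (1 + z *: w) * psY ^+ 3.
    by rewrite scalerDr !scalerAl /cusp; ring.
  have U0 : coef (1 + z *: u) 0 0 = 1 + u0 * z.
    by rewrite ps_coefD ps_coefZ ps_coef1 mulrC.
  have W0 : coef (1 + z *: w) 0 0 = 1 + w0 * z.
    by rewrite ps_coefD ps_coefZ ps_coef1 mulrC.
  have [c cE] := closed_cbrt ((1 + w0 * z) / (1 + u0 * z)).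
  apply: (cusp_form_orbit char2 (c := c)).
  - apply: contraNneq wz => c0; move/eqP: cE; rewrite c0 expr0n eq_sym mulf_eq0 invr_eq0.
    by rewrite (negPf uz) orbF.
  - by rewrite U0.
  by rewrite W0 U0 cE [RHS]mulrC divfK.
have t2 : tangent_at (jet_orbit k (cusp L)) (jet k (cusp L)) (jet k (v * (psX * psY ^+ 2))).
  apply: (@tangent_at_jets k _ 1 _ _ (v ^+ 2 * (psX ^+ 2 * psY)) (v ^+ 3 * psX ^+ 3)).
    exact: oner_neq0.
  move=> z _; apply: jet_orbit_corbit.
  have -> : cusp L + z *: (v * (psX * psY ^+ 2)) + z ^+ 2 *: (v ^+ 2 * (psX ^+ 2 * psY)) +
      z ^+ 3 *: (v ^+ 3 * psX ^+ 3) = psX ^+ 2 + (psY + (z *: v) * psX) ^+ 3.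
    by rewrite mulXY !exprZn !scalerAl /cusp !addrA.
  have vX j : coef (z *: v * psX) 0 j = 0.
    by rewrite mulrC coef_mono_mul.
  apply: cusp_orbit_images => //.
    by rewrite ps_coefD vX addr0.
  by rewrite /jacobian !ps_coefD vX /= mul0r subr0 addr0 mul1r oner_eq0.
have t3 : tangent_at (jet_orbit k (cusp L)) (jet k (cusp L)) (jet k (psY ^+ 2)).
  apply: (@tangent_at_jets k _ 1 _ _ 0 0); first exact: oner_neq0.
  move=> z _; apply: jet_orbit_corbit; rewrite !scaler0 !addr0.
  have [s sz] := closed_sqrt z.
  have -> : cusp L + z *: psY ^+ 2 = (psX + s *: psY) ^+ 2 + psY ^+ 3.
    by rewrite ps_sqrD // exprZn sz /cusp addrAC.
  apply: cusp_orbit_images => //; first by rewrite ps_coefD ps_coefZ /= mulr0 addr0.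
  by rewrite /jacobian !ps_coefD !ps_coefZ /= !mulr0 !mulr1 addr0 subr0 oner_eq0.
apply: (tangent_at_comb (k := e) _ t3 (u := jet k (u * psX ^+ 2 + v * (psX * psY ^+ 2) + w * psY ^+ 3))).
  apply: (tangent_at_comb (k := 1) t1 t2) => p.
  by rewrite !ffunE !ps_coefD mul1r addrAC.
by move=> p; rewrite !ffunE ps_coefD ps_coefZ.
Qed.

Variables (K : fieldType) (iota : {rmorphism K -> L}).

Lemma map_cusp : map_ps iota (cusp K) = cusp L.
Proof.
apply: pseriesP => i j; rewrite coef_cusp /map_ps /= -/(cusp K).
by have := coef_cusp K i j; rewrite /cusp => /= ->; rewrite rmorphD !rmorph_nat.
Qed.

Definition tangent_space_seq : seq (nat * nat) := [:: (0, 0); (1, 0); (0, 1); (1, 1)]%N.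

(** The inclusion from left to right is already visible on 2-jets, where the
    orbit lies in the plane spanned by x^2 and y^2. *)
Lemma cusp_tangent_space : tangent_space iota (cusp K) = coefs_vanish tangent_space_seq.
Proof.
have jetE k (b : pseries K) : [ffun p => iota (jet k b p)] = jet k (map_ps iota b).
  by apply/ffunP => p; rewrite !ffunE.
rewrite /tangent_space /jet_tangent_space map_cusp; apply/seteqP; split=> b.
  move=> /(_ 2%N); rewrite /= jetE => tb p sp.
  have [p2 p20 p02] : [/\ (p.1 + p.2 <= 2)%N, jix 2 p.1 p.2 != jix 2 2 0 &
                          jix 2 p.1 p.2 != jix 2 0 2].
    by move: sp; rewrite !inE => /or4P[] /eqP ->; rewrite !jix_neq.
  have := tangent_coord tb (j := jix 2 p.1 p.2); rewrite jet_jix //= => e.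
  apply/eqP; rewrite -(fmorph_eq0 iota); apply/eqP/e => c.
  by rewrite jet_orbitE // => -[_]; apply.
move=> b0 k /=; rewrite jetE.
have [u [v [w bE]]] : exists u v w, map_ps iota b - (iota (coef b 0 2)) *: psY ^+ 2 =
    u * psX ^+ 2 + v * (psX * psY ^+ 2) + w * psY ^+ 3.
  apply: tangent_image_seqP => p; rewrite monoY2 ps_coefB ps_coefZ.
  rewrite -[tangent_image_seq]/(rcons tangent_space_seq (0, 2)%N) mem_rcons inE.
  case: (eqVneq p (0, 2)%N) => [-> _|p02 /= sp]; first by rewrite /= mulr1 subrr.
  have -> : iota (coef b p.1 p.2) = 0 by rewrite b0 ?rmorph0.
  case: p p02 sp => i j /= p02 _; case: andP => [[/eqP i0 /eqP j2]|_].
    by rewrite i0 j2 eqxx in p02.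
  by rewrite mulr0 subr0.
rewrite -(subrK ((iota (coef b 0 2)) *: psY ^+ 2) (map_ps iota b)) bE.
exact: cusp_tangent_sub.
Qed.

End TangentSpace.

(* L is the algebraic closure of K, embedded by iota. *)
Theorem mainTheorem3 (K : fieldType) (char2 : 2%N \in [pchar K])
    (L : closedFieldType) (iota : {rmorphism K -> L})
    (Lalg : forall z : L, algebraicOver iota z) :
  let f : pseries K := psX ^+ 2 + psY ^+ 3 in
  let fL : pseries L := map_ps iota f in
  tangent_image f `<` tangent_space iota f /\
  (* (1) *)
  (tangent_image f = ideal_gen [set psX ^+ 2; psX * psY ^+ 2; psY ^+ 3] /\
   has_codim (tangent_image f) 5) /\
  (* (2) *)
  (determined 4 f /\ predeterminacy_bound f 2) /\
  (* (3) *)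
  has_codim (ideal_exp (@maxideal K) 3) 6 /\
  (* (4) *)
  (has_dim (jet_group L 2) 16 /\ has_dim (jet_stabilizer 2 fL) 14) /\
  (* (5) *)
  [/\ has_dim (jet_orbit 2 fL) 2,
      has_codim_in [set: {ffun jet_index 2 -> L}] (jet_orbit 2 fL) 4,
      has_codim (tangent_space iota f) 4 &
      ~ separable_morphism (jet_group L 2) (jet_orbit 2 fL) (orbit_map 2 fL)].
Proof.
move=> f fL; have char2L : 2%N \in [pchar L] := rmorph_pchar iota char2.
have -> : fL = cusp L := map_cusp iota.
have imE : tangent_image f = coefs_vanish tangent_image_seq.
  by rewrite -tangent_monomials; apply: cusp_tangent_image.
have spE : tangent_space iota f = coefs_vanish tangent_space_seq.
  exact: cusp_tangent_space.
split; first rewrite imE spE; split.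
- by move=> g g0 p sp; apply: g0; rewrite -[tangent_image_seq]/(rcons tangent_space_seq (0, 2)%N)
    mem_rcons inE sp orbT.
- move=> /(_ (psY ^+ 2)) sub.
  have : coefs_vanish tangent_image_seq (psY ^+ 2 : pseries K).
    apply: sub => p; rewrite monoY2.
    by move=> ps; move: ps; rewrite !inE => /or4P[] /eqP ->.
  move=> /(_ (0, 2)%N isT); rewrite monoY2 /= => /eqP.
  by rewrite oner_eq0.
- split; first exact: cusp_tangent_image.
  by rewrite imE; apply: (@coefs_vanish_codim K tangent_image_seq).
split; first by split; [apply: cusp_determined|apply: cusp_predeterminacy].
split; first exact: ideal_exp_max_codim3.
split; first by split; [apply: jet_group_dim|apply: jet_stabilizer_dim].
split; [exact: jet_orbit_dim|exact: jet_orbit_codim| |exact: orbit_map_inseparable].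
by rewrite spE; apply: (@coefs_vanish_codim K tangent_space_seq).
Qed.
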